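(* Let $\{X_k\}_{k\in\mathbb{N}}$ be a sequence of real random variables with $\mathbb{E}X_k=0$ and $|X_k|\le C$ for all $k$ (some constant $C>0$), and for complex $z$ let $F(z):=\sum_{k=1}^\infty X_k/k^z$. Let $1/2<\sigma_0\le 1$. Suppose $\{X_k\}$ is either (a) independent, (b) a martingale difference sequence, or (c) $\rho^*$-mixing. Then almost surely, uniformly for $\sigma_0\le\sigma\le1$, $$F(\sigma+it)\ll (\log t)^{\vartheta(1-\sigma)}\log\log t \quad (t\to\infty),$$ where $\vartheta=1$ in case (a), $\vartheta=2$ in case (b), $\vartheta=3$ in case (c). Moreover, if $X_k=0$ for every non-prime $k$, then the factor $\log\log t$ may be replaced by $\log\log\log t$.
   Context: For sub-$\sigma$-algebras $\mathcal{F}_1,\mathcal{F}_2$, let $\rho(\mathcal{F}_1,\mathcal{F}_2)$ be the supremum of $|\mathrm{Corr}(g_1,g_2)|$ over non-constant square-integrable $g_1$ measurable w.r.t. $\mathcal{F}_1$ and $g_2$ measurable w.r.t. $\mathcal{F}_2$. For $S\subset\mathbb{N}$ let $\mathcal{F}_S=\sigma(X_k:k\in S)$ and $\rho^*(n)=\sup\{\rho(\mathcal{F}_S,\mathcal{F}_T): S,T\subset\mathbb{N},\ \min_{s\in S,t\in T}|s-t|\ge n\}$. The sequence is $\rho^*$-mixing if $\rho^*(n)\to0$. A martingale difference sequence means $X_k=M_k-M_{k-1}$ for a martingale $(M_n,\mathcal{F}_n)_{n\ge0}$. $F(\sigma+it)$ denotes the (almost surely convergent) sum of the series for $\mathrm{Re}(z)>1/2$;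 ''$\ll$'' means bounded by a (random, finite) constant times the right side for all large $t$. *)

(* Defs.v *)
From HB Require Import structures.
From mathcomp Require Import all_boot all_order all_algebra.
From mathcomp Require Import finmap complex.
From mathcomp Require Import all_classical all_reals all_analysis.

Set Implicit Arguments.
Unset Strict Implicit.
Unset Printing Implicit Defensive.

Import Order.TTheory GRing.Theory Num.Theory numFieldNormedType.Exports.

Local Open Scope classical_set_scope.
Local Open Scope complex_scope.
Local Open Scope ring_scope.

(* Sequences X_1, X_2, ... are given as functions on nat of which only the
   values at positive indices matter. *)
Definition pos_index : set nat := [set k | (0 < k)%N].

Section Dirichlet.
Variable R : realType.

Definition cexp (z : R[i]) : R[i] :=
  (expR (complex.Re z))%:C *
  (cos (complex.Im z) +i* sin (complex.Im z)).

Definition natcpow (k : nat) (z : R[i]) : R[i] := cexp (z * (ln k%:R)%:C).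

(* R[i]^o is R[i] with the topology given by the complex modulus. *)
Definition dirichlet_partial (x : nat -> R) (z : R[i]) (n : nat) : R[i]^o :=
  \sum_(1 <= k < n.+1) (x k)%:C / natcpow k z.

(* The limit is a junk value when the partial sums do not converge. *)
Definition dirichlet_sum (x : nat -> R) (z : R[i]) : R[i] :=
  limn (dirichlet_partial x z).

End Dirichlet.

Section Dependence.
Context (d : measure_display) (T : measurableType d) (R : realType).
Variable P : probability T R.

Definition mutually_independent (X : nat -> T -> R) : Prop :=
  forall (J : {fset nat}) (B : nat -> set R),
    (forall k, k \in J -> (0 < k)%N) ->
    (forall k, k \in J -> measurable (B k)) ->
    P (\bigcap_(k in [set` J]) X k @^-1` B k) =
      (\prod_(k <- J) P (X k @^-1` B k))%E.

Definition sub_sigma_algebra_of (G : set (set T)) : Prop :=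
  sigma_algebra setT G /\ G `<=` measurable.

Definition measurable_wrt (G : set (set T)) (g : T -> R) : Prop :=
  forall B : set R, measurable B -> G (g @^-1` B).

(* Z is a version of E[Y | G]. *)
Definition is_cond_expectation (G : set (set T)) (Y Z : T -> R) : Prop :=
  [/\ measurable_wrt G Z,
      P.-integrable setT (EFin \o Y),
      P.-integrable setT (EFin \o Z)
    & forall A, G A -> (\int[P]_(w in A) (Z w)%:E = \int[P]_(w in A) (Y w)%:E)%E].

Definition filtration (F : nat -> set (set T)) : Prop :=
  (forall n, sub_sigma_algebra_of (F n)) /\
  (forall m n, (m <= n)%N -> F m `<=` F n).

Definition martingale (F : nat -> set (set T)) (M : nat -> T -> R) : Prop :=
  [/\ filtration F,
      forall n, measurable_wrt (F n) (M n),
      forall n, P.-integrable setT (EFin \o M n)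
    & forall n, is_cond_expectation (F n) (M n.+1) (M n)].

Definition martingale_difference (X : nat -> T -> R) : Prop :=
  exists (F : nat -> set (set T)) (M : nat -> T -> R),
    martingale F M /\
    forall k, (0 < k)%N -> {ae P, forall w, X k w = M k w - M k.-1 w}.

Definition corr (g h : T -> R) : R :=
  fine (covariance P g h) /
  (Num.sqrt (fine ('V_P[g])%E) * Num.sqrt (fine ('V_P[h])%E)).

(* Non-constancy is nonzero variance, i.e. not almost surely constant.  The
   set lies in [0, 1] by Cauchy-Schwarz; the real sup of the empty set, which
   occurs when G1 or G2 is trivial, is 0. *)
Definition rho (G1 G2 : set (set T)) : R :=
  sup [set r | exists g1 g2 : T -> R,
    [/\ measurable_wrt G1 g1 /\ measurable_wrt G2 g2,
        g1 \in Lfun P 2%:E /\ g2 \in Lfun P 2%:E,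
        ('V_P[g1] != 0)%E /\ ('V_P[g2] != 0)%E
      & r = `|corr g1 g2|]].

Definition sigma_gen (X : nat -> T -> R) (S : set nat) : set (set T) :=
  <<s \bigcup_(k in S) preimage_set_system setT (X k) measurable >>.

Definition rho_star (X : nat -> T -> R) (n : nat) : R :=
  sup [set r | exists S S' : set nat,
    [/\ S `<=` pos_index /\ S' `<=` pos_index,
        S !=set0 /\ S' !=set0,
        forall s t, S s -> S' t -> (n <= `|s%:Z - t%:Z|)%N
      & r = rho (sigma_gen X S) (sigma_gen X S')]].

Definition rho_star_mixing (X : nat -> T -> R) : Prop :=
  rho_star X n @[n --> \oo] --> (0 : R).

End Dependence.

(* Main.v *)
(** The sum of X_k k^(-in) over a dyadic block 2^j <= k < b has moments of order 2m
    at most (K m^vartheta 2^j)^m, with vartheta = 1, 2, 3 in the three cases: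

    - for martingale differences (and independent variables, which are martingale
      differences for their natural filtration) the inequality e^y <= y + e^(2 y^2)
      gives subgaussian exponential moments;

    - under rho*-mixing one splits the indices into residue classes modulo some n0
      with rho*(n0) <= 1/2.  Let A, B be the parts of a sum over two disjoint sets of
      indices of one class, and f(x) = x^m with m odd.  Choosing a common shift c
      with E f(A - c) + E f(B - c) = 0, the correlation bound gives
      E (f(A - c) - f(B - c))^2 >= (E (A - c)^(2m) + E (B - c)^(2m)) / 2, whence
      E (A + B)^(2m) <= (K m^2)^m E (A - B)^(2m).  Averaging over all splittings and
      applying Khinchine's inequality costs one more factor m^m.

    Taking m of the order of log n + j, a Borel-Cantelli argument over all integers
    n, all j and all b bounds the block sums by G 2^(j/2) (log n + j)^(vartheta/2)
    for a random constant G.  Abel summation with the weights k^(-sigma-is), whose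
    variation over a dyadic block is O(2^(-j sigma)), passes to t = n + s and to all
    sigma at once.  The series is cut at 2^J ~ (log t)^vartheta: the tail is
    O((log t)^(vartheta(1-sigma))), and the head is at most C 2^(J(1-sigma)) times
    the sum of 1/k over its support, i.e. O(J) in general and O(log J) over the
    primes by Chebyshev's bound. *)

Require Import Defs.
From HB Require Import structures.
From mathcomp Require Import all_boot all_order all_algebra.
From mathcomp Require Import finmap complex.
From mathcomp Require Import ring lra zify.
From mathcomp Require Import all_classical all_reals all_analysis measurable_realfun.

Set Implicit Arguments.
Unset Strict Implicit.
Unset Printing Implicit Defensive.

Import Order.TTheory GRing.Theory Num.Theory numFieldNormedType.Exports.

Local Open Scope classical_set_scope.
Local Open Scope complex_scope.
Local Open Scope ring_scope.

(** * Bounded measurable functions *)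

Section BoundedMeasurable.
Context (d : measure_display) (T : measurableType d) (R : realType).
Implicit Types (G : set (set T)) (f g : T -> R).

(** The argument runs on bounded functions: closure of this class under algebraic operations and
    [expR] replaces integrability arguments. *)
Definition bounded_wrt G f :=
  measurable_wrt G f /\ exists M : R, forall w, `|f w| <= M.

(** A sigma-algebra equals the one it generates, so on [g_sigma_algebraType G] the closure lemmas
    for measurable functions become available. *)
Lemma measurable_wrtP G f : sigma_algebra setT G ->
  measurable_wrt G f <-> measurable_fun setT (f : g_sigma_algebraType G -> R).
Proof.
move=> sG; have GE : <<s G >> = G by apply: sigma_algebra_id.
split=> [mf _ B mB|mf B mB].
  by rewrite setTI; change (<<s G >> (f @^-1` B)); rewrite GE; exact: mf.
have := mf measurableT B mB.
by rewrite setTI => fB; rewrite -GE; exact: fB.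
Qed.

Lemma measurable_wrt_measurable f :
  measurable_wrt measurable f <-> measurable_fun setT f.
Proof.
split=> [mf _ B mB|mf B mB]; first by rewrite setTI; exact: mf.
by rewrite -[_ @^-1` _]setTI; exact: mf.
Qed.

Lemma bounded_wrtS G G' f : G `<=` G' -> bounded_wrt G f -> bounded_wrt G' f.
Proof. by move=> GG' [mf bf]; split => // B /mf /GG'. Qed.

Section Closure.
Variable G : set (set T).
Hypothesis sG : sigma_algebra setT G.

Lemma bounded_wrt_cst (c : R) : bounded_wrt G (fun=> c).
Proof.
by split; [apply/(measurable_wrtP _ sG); exact: measurable_cst|exists `|c|].
Qed.

Lemma bounded_wrtD f g : bounded_wrt G f -> bounded_wrt G g ->
  bounded_wrt G (fun w => f w + g w).
Proof.
move=> [/(measurable_wrtP _ sG) mf [M Mf]] [/(measurable_wrtP _ sG) mg [N Ng]].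
split; first by apply/(measurable_wrtP _ sG); exact: measurable_funD.
by exists (M + N) => w; apply: (le_trans (ler_normD _ _)); exact: lerD.
Qed.

Lemma bounded_wrtM f g : bounded_wrt G f -> bounded_wrt G g ->
  bounded_wrt G (fun w => f w * g w).
Proof.
move=> [/(measurable_wrtP _ sG) mf [M Mf]] [/(measurable_wrtP _ sG) mg [N Ng]].
split; first by apply/(measurable_wrtP _ sG); exact: measurable_funM.
by exists (M * N) => w; rewrite normrM; exact: ler_pM.
Qed.

Lemma bounded_wrtN f : bounded_wrt G f -> bounded_wrt G (fun w => - f w).
Proof.
move=> bf; have := bounded_wrtM (bounded_wrt_cst (-1)) bf.
by under eq_fun do rewrite mulN1r.
Qed.

Lemma bounded_wrtX f n : bounded_wrt G f -> bounded_wrt G (fun w => f w ^+ n).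
Proof.
move=> bf; elim: n => [|n IHn]; first exact: bounded_wrt_cst.
by under eq_fun do rewrite exprS; exact: bounded_wrtM.
Qed.

Lemma bounded_wrt_sum (I : Type) (r : seq I) (Q : pred I) (F : I -> T -> R) :
  (forall i, Q i -> bounded_wrt G (F i)) ->
  bounded_wrt G (fun w => \sum_(i <- r | Q i) F i w).
Proof.
move=> bF; elim: r => [|i r IHr].
  by under eq_fun do rewrite big_nil; exact: bounded_wrt_cst.
under eq_fun do rewrite big_cons.
have [Qi|nQi] := boolP (Q i); last by [].
by apply: bounded_wrtD => //; exact: bF.
Qed.

Lemma bounded_wrt_expR f : bounded_wrt G f -> bounded_wrt G (fun w => expR (f w)).
Proof.
move=> [/(measurable_wrtP _ sG) mf [M Mf]]; split.
  by apply/(measurable_wrtP _ sG); exact: measurableT_comp.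
exists (expR M) => w; rewrite ger0_norm ?expR_ge0// ler_expR.
exact: le_trans (ler_norm _) (Mf w).
Qed.

End Closure.
End BoundedMeasurable.

(** Follows the syntax of the function; what no closure rule or hypothesis settles is left to the
    caller. *)
Ltac bounded := match goal with
  | H : bounded_wrt ?G ?f |- bounded_wrt ?G ?f => exact H
  | |- bounded_wrt _ (fun=> ?c) => apply: bounded_wrt_cst; bounded
  | |- bounded_wrt _ (fun w => _ ^+ _) => apply: bounded_wrtX; bounded
  | |- bounded_wrt _ (fun w => _ * _) => apply: bounded_wrtM; bounded
  | |- bounded_wrt _ (fun w => - _) => apply: bounded_wrtN; bounded
  | |- bounded_wrt _ (fun w => _ + _) => apply: bounded_wrtD; bounded
  | |- bounded_wrt _ (fun w => expR _) => apply: bounded_wrt_expR; bounded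
  | |- bounded_wrt _ (fun w => \sum_(i <- _ | _) _) =>
      apply: bounded_wrt_sum => *; bounded
  | |- sigma_algebra _ measurable => exact: sigma_algebra_measurable
  | _ => first [assumption | by eauto | idtac]
  end.

(** * Expectation of bounded functions *)

Section Mean.
Context (d : measure_display) (T : measurableType d) (R : realType).
Variable P : probability T R.
Implicit Types f g : T -> R.

Definition mean f : R := \int[P]_w f w.

Let measure_setT1 : (P : {measure set T -> \bar R}) setT = 1%E.
Proof. exact: probability_setT. Qed.

Lemma bounded_integrable f : bounded_wrt measurable f ->
  P.-integrable setT (EFin \o f).
Proof.
move=> [/measurable_wrt_measurable mf [M Mf]].
apply: measurable_bounded_integrable => //.
  by rewrite measure_setT1 ltry.
exists M; split; first exact: num_real.
by move=> x Mx w _; apply: le_trans (Mf w) (ltW Mx).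
Qed.

Lemma bounded_Lfun f (p : R) : 1 <= p -> bounded_wrt measurable f ->
  f \in Lfun P p%:E.
Proof.
move=> p1 bf; have [/measurable_wrt_measurable mf [M Mf]] := bf.
have M0 : 0 <= M by have := le_trans (normr_ge0 _) (Mf point).
rewrite inE; apply/andP; split; rewrite inE//=.
rewrite /finite_norm unlock; apply: poweR_lty.
apply: (@le_lt_trans _ _ (\int[P]_w (M `^ p)%:E)%E).
  apply: ge0_le_integral => //=.
  - apply/measurable_EFinP.
    by apply: (measurableT_comp (measurable_powR _)); exact: measurableT_comp.
  - move=> w _; rewrite lee_fin ge0_ler_powR ?nnegrE//.
    by rewrite (le_trans _ p1).
by rewrite integral_cst// measure_setT1 mule1 ltry.
Qed.

Lemma mean_cst c : mean (fun=> c) = c.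
Proof. by rewrite /mean Rintegral_cst// measure_setT1/= mulr1. Qed.

Lemma meanD f g : bounded_wrt measurable f -> bounded_wrt measurable g ->
  mean (fun w => f w + g w) = mean f + mean g.
Proof. by move=> bf bg; rewrite /mean RintegralD//; exact: bounded_integrable. Qed.

Lemma meanZ c f : bounded_wrt measurable f ->
  mean (fun w => c * f w) = c * mean f.
Proof. by move=> bf; rewrite /mean RintegralZl//; exact: bounded_integrable. Qed.

Lemma meanB f g : bounded_wrt measurable f -> bounded_wrt measurable g ->
  mean (fun w => f w - g w) = mean f - mean g.
Proof. by move=> bf bg; rewrite /mean RintegralB//; exact: bounded_integrable. Qed.

Lemma le_mean f g : bounded_wrt measurable f -> bounded_wrt measurable g ->
  (forall w, f w <= g w) -> mean f <= mean g.
Proof.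
by move=> bf bg fg; apply: le_Rintegral => //; exact: bounded_integrable.
Qed.

Lemma mean_ge0 f : (forall w, 0 <= f w) -> 0 <= mean f.
Proof. by move=> f0; apply: Rintegral_ge0. Qed.

Lemma mean_sum (I : Type) (r : seq I) (Q : pred I) (F : I -> T -> R) :
  (forall i, Q i -> bounded_wrt measurable (F i)) ->
  mean (fun w => \sum_(i <- r | Q i) F i w) = \sum_(i <- r | Q i) mean (F i).
Proof.
move=> bF; elim: r => [|i r IHr].
  by under [X in mean X]eq_fun do rewrite big_nil; rewrite mean_cst big_nil.
under [X in mean X]eq_fun do rewrite big_cons; rewrite big_cons.
have [Qi|nQi] := boolP (Q i); last by [].
by rewrite meanD ?IHr//; [exact: bF|bounded].
Qed.

Lemma EFin_mean f : bounded_wrt measurable f ->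
  (mean f)%:E = (\int[P]_w (f w)%:E)%E.
Proof.
move=> bf; rewrite /mean /Rintegral fineK//.
by apply: integrable_fin_num => //; exact: bounded_integrable.
Qed.

Lemma mean_expectation f : bounded_wrt measurable f -> ('E_P[f] = (mean f)%:E)%E.
Proof. by move=> bf; rewrite EFin_mean// unlock. Qed.

Lemma norm_mean_le f (M : R) : bounded_wrt measurable f -> (forall w, `|f w| <= M) ->
  `|mean f| <= M.
Proof.
move=> bf fM; rewrite ler_norml -(mean_cst (- M)) -{2}(mean_cst M).
have fM' w : - M <= f w <= M by rewrite -ler_norml.
apply/andP; split; apply: le_mean => //; bounded.
- by move=> w; have /andP[] := fM' w.
- by move=> w; have /andP[] := fM' w.
Qed.

End Mean.

(** * Moments of martingale transforms *)

Section ExponentialInequalities.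
Variable R : realType.
Implicit Types x y : R.

(** For y <= 1/2, e^(-y) >= 1 - y gives e^y <= 1/(1 - y) <= 1 + y + 2 y^2; for y > 1/2, y <= 2 y^2.
    The point is the isolated linear term, which vanishes in mean. *)
Lemma expR_le_addr_expR y : expR y <= y + expR (2 * y ^+ 2).
Proof.
have [y2|y2] := leP y (1 / 2); last first.
  have : expR y <= expR (2 * y ^+ 2) by rewrite ler_expR; nra.
  by move=> h; lra.
have h1 : 1 - y <= expR (- y) := expR_ge1Dx (- y).
have h2 : expR y * expR (- y) = 1 by exact: expRxMexpNx_1.
have h3 : 1 + 2 * y ^+ 2 <= expR (2 * y ^+ 2) by exact: expR_ge1Dx.
have e0 := expR_gt0 y.
have h4 : expR y * (1 - y) <= 1 by rewrite -[leRHS]h2 ler_pM2l.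
have h5 : 1 <= (1 + y + 2 * y ^+ 2) * (1 - y) by nra.
have y1 : 0 < 1 - y by lra.
have h6 : expR y <= 1 + y + 2 * y ^+ 2.
  by rewrite -(ler_pM2r y1); exact: le_trans h5.
by lra.
Qed.

(** A single term of the exponential series of |x|. *)
Lemma exprn_le_expR_sum x n :
  x ^+ (2 * n) <= (2 * n)`!%:R * (expR x + expR (- x)).
Proof.
have e1 := expR_gt0 x; have e2 := expR_gt0 (- x).
have f0 : 0 < (2 * n)`!%:R :> R by rewrite ltr0n fact_gt0.
have -> : x ^+ (2 * n) = `|x| ^+ (2 * n).
  by rewrite !exprM real_normK ?num_real.
have h : expR `|x| <= expR x + expR (- x).
  by case: (ger0P x) => _; lra.
apply: (@le_trans _ _ ((2 * n)`!%:R * expR `|x|)); last by rewrite ler_pM2l.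
rewrite mulrC -ler_pdivrMr//.
case: n f0 => [_|n _]; first by rewrite expr0 divr1 -[leLHS]expR0 ler_expR.
have := expR_ge1Dxn (2 * n).+1 (normr_ge0 x).
have -> : (2 * n.+1)%N = (2 * n).+2 by lia.
by lra.
Qed.

(** With l^2 = m / B, [moment_cst] m B l^2 = (2m)^2 (2 e^2), whose m-th power dominates (2m)! <=
    (2m)^(2m) times 2 e^(2m). *)
Definition moment_cst : R := 8 * expR 2.

Lemma moment_cst_gt0 : 0 < moment_cst.
Proof. by rewrite mulr_gt0 ?expR_gt0. Qed.

(* Optimising the exponential moment bound at l ^ 2 = m / B. *)
Lemma mgf_moment_bound (m : nat) (B : R) : (0 < m)%N -> 0 < B ->
  exists2 l : R, 0 < l &
    (2 * m)`!%:R * (2 * expR (2 * l ^+ 2 * B)) <=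
    (moment_cst * m%:R * B) ^+ m * l ^+ (2 * m).
Proof.
move=> m0 B0; have m0' : 0 < m%:R :> R by rewrite ltr0n.
have q0 : 0 < m%:R / B by exact: divr_gt0.
exists (Num.sqrt (m%:R / B)); first by rewrite sqrtr_gt0.
rewrite exprM sqr_sqrtr ?(ltW q0)// -exprMn.
have -> : 2 * (m%:R / B) * B = m%:R * 2 by rewrite -mulrA divfK ?gt_eqF// mulrC.
rewrite expRM_natl.
have -> : moment_cst * m%:R * B * (m%:R / B) = (2 * m%:R) ^+ 2 * (2 * expR 2).
  by rewrite /moment_cst; field; rewrite gt_eqF.
rewrite exprMn; apply: ler_pM => //.
- rewrite -exprM -natrM -natrX ler_nat.
  elim: (2 * m)%N => [//|n IHn].
  rewrite factS expnS leq_mul//.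
  by apply: (leq_trans IHn); case: n {IHn} => // n; rewrite leq_exp2r.
- rewrite exprMn ler_wpM2r ?exprn_ge0 ?expR_ge0//.
  by rewrite -{1}[2]expr1 ler_weXn2l// ler1n.
Qed.

End ExponentialInequalities.

Section Martingale.
Context (d : measure_display) (T : measurableType d) (R : realType).
Variable P : probability T R.

(** Odd [m] suffices later and is what the mixing case provides, where x^m must preserve signs. [V]
    is any positive bound of the sum of squares, so zero coefficients cause no degeneracy; [a 0 = 0]
    because sequences start at index 1. *)
Definition moment_bound (Y : nat -> T -> R) (th : nat) : Prop :=
  exists2 K : R, 0 < K &
  forall (b : nat) (a : nat -> R) (V : R) (m : nat),
    a 0%N = 0 -> 0 < V -> \sum_(k < b) a k ^+ 2 <= V -> odd m ->
    mean P (fun w => (\sum_(k < b) a k * Y k w) ^+ (2 * m)) <=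
      (K * m%:R ^+ th * V) ^+ m.

(** Since m >= 1. It takes the exponent 1 of martingale differences to the exponent 2 stated for
    them. *)
Lemma moment_boundS Y th : moment_bound Y th -> moment_bound Y th.+1.
Proof.
move=> [K K0 HK]; exists K => // b a V m a0 V0 aV om.
have m1 : 1 <= m%:R :> R by rewrite ler1n odd_gt0.
apply: (le_trans (HK b a V m a0 V0 aV om)).
have m0 : 0 <= m%:R :> R by [].
apply: lerXn2r; rewrite ?nnegrE ?mulr_ge0 ?exprn_ge0 ?(ltW K0) ?(ltW V0)//.
rewrite ler_pM2r// ler_pM2l// exprS ler_peMl// exprn_ge0//.
Qed.

(** The claim is immediate for finite combinations of indicators of [G]; a bounded [Z] is a uniform
    limit of such step functions. *)
Lemma mean_mul_eq0 (G : set (set T)) (Z Y : T -> R) :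
  sub_sigma_algebra_of G -> bounded_wrt G Z -> bounded_wrt measurable Y ->
  (forall A, G A -> \int[P]_(w in A) Y w = 0) ->
  mean P (fun w => Z w * Y w) = 0.
Proof.
move=> [sG GT] bZ bY YA0.
have bZ' := bounded_wrtS GT bZ.
have [mZ [M0 ZM0]] := bZ; have [mY [C0 YC0]] := bY.
pose M := `|M0|; pose C := `|C0|.
have ZM w : `|Z w| <= M by exact: le_trans (ZM0 w) (ler_norm _).
have YC w : `|Y w| <= C by exact: le_trans (YC0 w) (ler_norm _).
have M_ge0 : 0 <= M by exact: normr_ge0.
have C_ge0 : 0 <= C by exact: normr_ge0.
suff H (q : nat) : `|mean P (fun w => Z w * Y w)| <= C / q.+1%:R.
  apply/eqP; rewrite -normr_le0; apply/ler_addgt0Pr => e e0; rewrite add0r.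
  have [q /ltW qe] : exists q : nat, C / e < q.+1%:R.
    exists (Num.truncn (C / e)); exact: truncnS_gt.
  apply: (le_trans (H q)); rewrite ler_pdivrMr// mulrC -ler_pdivrMr//.
pose D : R := q.+1%:R^-1.
have D0 : 0 < D by rewrite invr_gt0.
(* Enough half-open cells of width [D] to cover [-M, M], including the right end. *)
pose n := (Num.truncn (2 * M / D)).+1.
pose A (i : nat) := Z @^-1` `[- M + i%:R * D, - M + i.+1%:R * D[.
pose c (i : nat) : R := - M + i%:R * D.
pose Zd w := \sum_(i < n) c i * \1_(A i) w.
have GA i : G (A i) by apply: mZ; exact: measurable_itv.
have mA i : measurable (A i) by exact: GT.
have bA i : bounded_wrt measurable (\1_(A i) : T -> R).
  split; first by apply/measurable_wrt_measurable; exact: measurable_indic.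
  by exists 1 => w; rewrite indicE; case: (_ \in _); rewrite ?normr1 ?normr0.
have ZdE w : 0 <= Z w - Zd w <= D.
  have zM : 0 <= (Z w + M) / D.
    apply: divr_ge0; last exact: ltW.
    by have := ZM w; rewrite ler_norml => /andP[? _]; lra.
  have /andP[t1 t2] := truncn_itv zM; set t := Num.truncn _ in t1 t2.
  have t1' : t%:R * D <= Z w + M by rewrite -ler_pdivlMr.
  have t2' : Z w + M < t.+1%:R * D by rewrite -ltr_pdivrMr.
  have tn : (t < n)%N.
    rewrite /n ltnS truncn_ge_nat; last by rewrite divr_ge0 ?mulr_ge0// ltW.
    rewrite ler_pdivlMr//; have := ZM w; rewrite ler_norml => /andP[_ ?]; lra.
  have AE (i : nat) : \1_(A i) w = (i == t)%:R :> R.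
    rewrite indicE; congr (nat_of_bool _)%:R; apply/idP/eqP => [|->].
      rewrite inE /A /= in_itv/= => /andP[i1 i2]; apply/eqP.
      have i1' : i%:R < t.+1%:R :> R by rewrite -(ltr_pM2r D0); lra.
      have i2' : t%:R < i.+1%:R :> R by rewrite -(ltr_pM2r D0); lra.
      by move: i1' i2'; rewrite !ltr_nat; lia.
    rewrite inE /A /= in_itv/=; apply/andP; split; lra.
  have -> : Zd w = c t.
    rewrite /Zd (bigD1 (Ordinal tn))//= AE eqxx mulr1 big1 ?addr0// => i it.
    by rewrite AE (_ : _ == t = false) ?mulr0//; apply/negbTE.
  by rewrite /c; move: t2'; rewrite -natr1 mulrDl mul1r => t2'; lra.
have bZd : bounded_wrt measurable Zd by rewrite /Zd; bounded; exact: bA.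
have ZdY0 : mean P (fun w => Zd w * Y w) = 0.
  have -> : (fun w => Zd w * Y w) =
      (fun w => \sum_(i < n) c i * (\1_(A i) w * Y w)).
    by apply/funext => w; rewrite /Zd mulr_suml; under eq_bigr do rewrite -mulrA.
  rewrite mean_sum => [|i _]; last by bounded; exact: bA.
  rewrite big1// => i _; rewrite meanZ; last by bounded; exact: bA.
  have -> : mean P (fun w => \1_(A i) w * Y w) = \int[P]_(w in A i) Y w.
    rewrite Rintegral_mkcond; apply: eq_Rintegral => w _.
    by rewrite patchE indicE; case: ifP; rewrite ?mul1r ?mul0r.
  by rewrite YA0// mulr0.
rewrite -[mean _ _]subr0 -ZdY0 -meanB; [|by bounded|by bounded].
rewrite mulrC -/D; apply: norm_mean_le; first by bounded.
move=> w; rewrite -mulrBl normrM; apply: ler_pM => //.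
by have /andP[? ?] := ZdE w; rewrite ger0_norm.
Qed.

Section Moments.
Variables (F : nat -> set (set T)) (Y : nat -> T -> R) (C : R).
Hypotheses (filF : filtration F) (bY : forall k, bounded_wrt (F k) (Y k)).
Hypotheses (C_gt0 : 0 < C) (YC : forall k w, `|Y k w| <= C).
Hypothesis YA0 : forall k A, F k A -> \int[P]_(w in A) Y k.+1 w = 0.

(** Induction on the number of terms: [expR_le_addr_expR] replaces the last exponential by a linear
    term, orthogonal to the past, plus a constant. *)
Lemma martingale_mgf (a : nat -> R) n : a 0%N = 0 ->
  mean P (fun w => expR (\sum_(k < n) a k * Y k w)) <=
    expR (2 * C ^+ 2 * \sum_(k < n) a k ^+ 2).
Proof.
move=> a0; have [sF F_nd] := filF.
have bY' k : bounded_wrt measurable (Y k) := bounded_wrtS (sF k).2 (bY k).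
elim: n => [|n IHn].
  under [X in mean _ X]eq_fun do rewrite big_ord0 expR0.
  by rewrite mean_cst big_ord0 mulr0 expR0.
rewrite big_ord_recr/= mulrDr expRD.
under [X in mean _ X]eq_fun do rewrite big_ord_recr/= expRD.
(* The term of index 0 is removed by [a 0 = 0], as [YA0] speaks only of successor indices. *)
case: n IHn => [|n] IHn.
  by under [X in mean _ X]eq_fun do rewrite a0 mul0r expR0 mulr1;
    rewrite a0 expr0n/= mulr0 expR0 mulr1.
set S := fun w => expR (\sum_(k < n.+1) a k * Y k w).
set E := expR _ in IHn *; set e := expR (2 * C ^+ 2 * a n.+1 ^+ 2).
have bS : bounded_wrt (F n) S.
  rewrite /S; apply: bounded_wrt_expR; first exact: (sF n).1.
  apply: bounded_wrt_sum => [|i _]; first exact: (sF n).1.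
  apply: bounded_wrtM; [exact: (sF n).1| |].
    by apply: bounded_wrt_cst; exact: (sF n).1.
  by apply: bounded_wrtS (bY i); apply: F_nd; rewrite -ltnS.
have bS' := bounded_wrtS (sF n).2 bS.
have SY0 : mean P (fun w => S w * Y n.+1 w) = 0.
  by apply: (mean_mul_eq0 (sF n) bS (bY' _)); exact: YA0.
apply: (@le_trans _ _ (mean P (fun w => a n.+1 * (S w * Y n.+1 w) + e * S w))).
  apply: le_mean; [by bounded|by bounded|move=> w].
  have S0 : 0 < S w by exact: expR_gt0.
  rewrite mulrCA [e * _]mulrC -mulrDr ler_pM2l//.
  apply: (le_trans (expR_le_addr_expR _)); rewrite lerD2l ler_expR.
  rewrite exprMn -mulrA ler_pM2l// mulrC ler_wpM2r ?sqr_ge0//.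
  by rewrite -(real_normK (num_real (Y n.+1 w))) lerXn2r ?nnegrE// ltW.
rewrite meanD; [|by bounded|by bounded].
rewrite !meanZ; [|by bounded|by bounded].
by rewrite SY0 mulr0 add0r mulrC ler_wpM2r// expR_ge0.
Qed.

Lemma martingale_moment_bound : moment_bound Y 1.
Proof.
have bY' k : bounded_wrt measurable (Y k) := bounded_wrtS (filF.1 k).2 (bY k).
exists (moment_cst R * C ^+ 2).
  by rewrite mulr_gt0 ?exprn_gt0 ?moment_cst_gt0.
move=> b a V m a0 V0 aV om.
have m0 := odd_gt0 om.
have B0 : 0 < C ^+ 2 * V by rewrite mulr_gt0 ?exprn_gt0.
have [l l0 Hl] := mgf_moment_bound m0 B0.
pose S w := \sum_(k < b) a k * Y k w.
have bS : bounded_wrt measurable S by rewrite /S; bounded; exact: bY'.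
(* To be used for s = l and s = -l, the two exponentials of [exprn_le_expR_sum]. *)
have mgf (s : R) : s ^+ 2 = l ^+ 2 ->
    mean P (fun w => expR (s * S w)) <= expR (2 * l ^+ 2 * (C ^+ 2 * V)).
  move=> sl; have := @martingale_mgf (fun k => s * a k) b.
  rewrite a0 mulr0 => /(_ erefl).
  have -> : (fun w => expR (\sum_(k < b) s * a k * Y k w)) =
      (fun w => expR (s * S w)).
    by apply/funext => w; rewrite /S mulr_sumr; under eq_bigr do rewrite -mulrA.
  move/le_trans; apply; rewrite ler_expR.
  under eq_bigr do rewrite exprMn.
  rewrite -mulr_sumr sl; set W := \sum_(k < b) _ in aV *.
  have l2 : 0 < l ^+ 2 by exact: exprn_gt0.
  have C2 : 0 < C ^+ 2 by exact: exprn_gt0.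
  have := ler_wpM2l (ltW (mulr_gt0 C2 l2)) aV.
  by nra.
have lm : 0 < l ^+ (2 * m) by exact: exprn_gt0.
rewrite -(ler_pM2r lm) expr1 -[_ * C ^+ 2 * _]mulrA [C ^+ 2 * m%:R]mulrC.
rewrite mulrA -[_ * C ^+ 2 * V]mulrA.
apply: le_trans Hl; rewrite mulrC -meanZ; last by bounded.
apply: (@le_trans _ _ (mean P (fun w =>
    (2 * m)`!%:R * (expR (l * S w) + expR (- l * S w))))).
  apply: le_mean; [by bounded|by bounded|move=> w].
  by rewrite -exprMn mulNr; exact: exprn_le_expR_sum.
rewrite meanZ; last by bounded.
rewrite meanD; [|by bounded|by bounded].
rewrite ler_wpM2l// mulr2n mulrDl mul1r.
by apply: lerD; apply: mgf; rewrite ?sqrrN.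
Qed.

End Moments.
End Martingale.

(** * Moments under mixing *)

Section PowerInequalities.
Variable R : realType.
Implicit Types x y a b : R.

Lemma exprn_even_norm x m : x ^+ (2 * m) = `|x| ^+ (2 * m).
Proof. by rewrite !exprM real_normK ?num_real. Qed.

Lemma exprn_even_ge0 x m : 0 <= x ^+ (2 * m).
Proof. by rewrite exprM exprn_ge0// sqr_ge0. Qed.

Lemma ler_exprn_even x y m : `|x| <= y -> x ^+ (2 * m) <= y ^+ (2 * m).
Proof.
move=> xy; rewrite exprn_even_norm lerXn2r ?nnegrE//.
exact: le_trans xy.
Qed.

Lemma exprD_even_le x y m :
  (x + y) ^+ (2 * m) <= 4 ^+ m * (x ^+ (2 * m) + y ^+ (2 * m)).
Proof.
wlog xy : x y / `|x| <= `|y|.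
  move=> H; have [/H//|/ltW/H] := leP `|x| `|y|.
  by rewrite addrC [X in _ <= _ * X]addrC.
have h : (x + y) ^+ (2 * m) <= (2 * `|y|) ^+ (2 * m).
  apply: ler_exprn_even; apply: (le_trans (ler_normD _ _)); lra.
apply: (le_trans h).
rewrite exprMn -exprn_even_norm exprM (_ : 2 ^+ 2 = 4); last by ring.
by rewrite ler_wpM2l ?exprn_ge0// lerDr exprn_even_ge0.
Qed.

Lemma sum_exprn_even_le n (x : 'I_n -> R) m : (0 < m)%N ->
  (\sum_(i < n) x i) ^+ (2 * m) <= n%:R ^+ (2 * m) * \sum_(i < n) x i ^+ (2 * m).
Proof.
case: n x => [|n] x m0.
  by rewrite !big_ord0 mulr0 expr0n muln_eq0 (gtn_eqF m0).
have [i _ xi] := @arg_maxP _ R 'I_n.+1 ord0 xpredT (fun i => `|x i|) isT.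
apply: (@le_trans _ _ ((n.+1%:R * `|x i|) ^+ (2 * m))).
  apply: ler_exprn_even; apply: (le_trans (ler_norm_sum _ _ _)).
  rewrite -[n.+1 in leRHS]card_ord mulr_natl -sumr_const.
  by apply: ler_sum => j _; exact: xi.
rewrite exprMn ler_wpM2l ?exprn_ge0// -exprn_even_norm (bigD1 i)//= lerDl.
by apply: sumr_ge0 => j _; exact: exprn_even_ge0.
Qed.

Lemma bernoulli_le y m : 0 <= y -> 1 + m%:R * (y - 1) <= y ^+ m.
Proof.
move=> y0; elim: m => [|m IHm]; first by rewrite mul0r addr0 expr0.
rewrite exprS -natr1; have := ler_wpM2l y0 IHm.
have : 0 <= m%:R * (y - 1) ^+ 2 by rewrite mulr_ge0// sqr_ge0.
by nra.
Qed.

Lemma subrX_norm_le a b M m : `|a| <= M -> `|b| <= M ->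
  `|a ^+ m - b ^+ m| <= `|a - b| * (m%:R * M ^+ m.-1).
Proof.
move=> aM bM; rewrite subrXX normrM ler_wpM2l//.
apply: (le_trans (ler_norm_sum _ _ _)).
rewrite -[m in m%:R]card_ord mulr_natl -sumr_const ler_sum// => i _.
have -> : M ^+ m.-1 = M ^+ (m.-1 - i) * M ^+ i.
  by rewrite -exprD subnK//; have := ltn_ord i; lia.
by rewrite normrM !normrX ler_pM// lerXn2r ?nnegrE// (le_trans _ aM).
Qed.

(* Splitting on whether max(a^2, b^2) exceeds 4 m^2 (a - b)^2 replaces
   Hölder's inequality. *)
Lemma subrX_sqr_le a b m : (0 < m)%N ->
  (a ^+ m - b ^+ m) ^+ 2 <=
    (a ^+ (2 * m) + b ^+ (2 * m)) / 4 + (4 * m%:R ^+ 2 * (a - b) ^+ 2) ^+ m.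
Proof.
wlog ab : a b / `|a| <= `|b|.
  move=> H m0; have [/H/(_ m0)//|/ltW/H/(_ m0)] := leP `|a| `|b|.
  by rewrite [X in X / 4]addrC -opprB sqrrN -(opprB b a) sqrrN.
move=> m0; have h := subrX_norm_le m ab (lexx `|b|).
pose y := b ^+ 2; pose x := m%:R ^+ 2 * (a - b) ^+ 2.
have y0 : 0 <= y by exact: sqr_ge0.
have x0 : 0 <= x by rewrite mulr_ge0 ?sqr_ge0.
have {}h : (a ^+ m - b ^+ m) ^+ 2 <= x * y ^+ m.-1.
  rewrite -real_normK ?num_real//.
  apply: (le_trans (lerXn2r _ _ _ h)); rewrite ?nnegrE ?mulr_ge0 ?exprn_ge0//.
  have bE : (`|b| ^+ m.-1) ^+ 2 = y ^+ m.-1.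
    by rewrite exprAC real_normK ?num_real.
  have -> : (`|a - b| * (m%:R * `|b| ^+ m.-1)) ^+ 2 =
      m%:R ^+ 2 * `|a - b| ^+ 2 * (`|b| ^+ m.-1) ^+ 2 by ring.
  by rewrite bE real_normK ?num_real.
apply: (le_trans h).
have Y : y ^+ m = b ^+ (2 * m) by rewrite /y exprM.
have a0 := exprn_even_ge0 a m; have b0 := exprn_even_ge0 b m.
have -> : 4 * m%:R ^+ 2 * (a - b) ^+ 2 = 4 * x by rewrite /x mulrA.
have [yx|/ltW yx] := leP (4 * x) y.
  have : x * y ^+ m.-1 <= y ^+ m / 4.
    have -> : y ^+ m = y * y ^+ m.-1 by rewrite -exprS prednK.
    have xy : x <= y / 4 by rewrite ler_pdivlMr// mulrC.
    by rewrite [leRHS]mulrAC; apply: ler_wpM2r xy; exact: exprn_ge0.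
  rewrite Y => /le_trans; apply.
  have : 0 <= (4 * x) ^+ m by rewrite exprn_ge0// mulr_ge0.
  by lra.
have : x * y ^+ m.-1 <= (4 * x) ^+ m.
  have -> : (4 * x) ^+ m = 4 * x * (4 * x) ^+ m.-1 by rewrite -exprS prednK.
  have xx : x <= 4 * x by rewrite ler_peMl// ler1n.
  apply: ler_pM => //; first exact: exprn_ge0.
  by rewrite lerXn2r ?nnegrE// mulr_ge0.
by lra.
Qed.

End PowerInequalities.

Section Khinchine.
Variable R : realType.

Definition signed (b : nat) (s : {ffun 'I_b -> bool}) (i : 'I_b) (x : R) : R :=
  if s i then x else - x.

(** The sum over all signs of the exponential factors over the coordinates; in each factor the
    linear terms of [expR_le_addr_expR] cancel between the two signs. The moment bound follows as in
    the martingale case. *)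
Lemma khinchine (b m : nat) (x : 'I_b -> R) (B : R) :
  (0 < m)%N -> 0 < B -> \sum_(i < b) x i ^+ 2 <= B ->
  \sum_(s : {ffun 'I_b -> bool}) (\sum_(i < b) signed s i (x i)) ^+ (2 * m) <=
    2 ^+ b * (moment_cst R * m%:R * B) ^+ m.
Proof.
move=> m0 B0 xB; have [l l0 Hl] := mgf_moment_bound m0 B0.
have lm : 0 < l ^+ (2 * m) by exact: exprn_gt0.
have mgf (r : R) : r ^+ 2 = l ^+ 2 ->
    \sum_(s : {ffun 'I_b -> bool}) expR (r * \sum_(i < b) signed s i (x i)) <=
    2 ^+ b * expR (2 * l ^+ 2 * B).
  move=> rl.
  under eq_bigr do rewrite mulr_sumr expR_sum.
  have -> : \sum_(s : {ffun 'I_b -> bool}) \prod_(i < b) expR (r * signed s i (x i))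
      = \prod_(i < b) \sum_(e : bool) expR (r * (if e then x i else - x i)).
    by rewrite bigA_distr_bigA.
  have -> : 2 ^+ b = \prod_(i < b) (2 : R) by rewrite prodr_const card_ord.
  apply: (@le_trans _ _ (\prod_(i < b) (2 * expR (2 * (r * x i) ^+ 2)))).
    apply: ler_prod => i _; rewrite big_bool /= mulrN.
    have e1 := expR_le_addr_expR (r * x i).
    have := expR_le_addr_expR (- (r * x i)); rewrite sqrrN => e2.
    by rewrite addr_ge0 ?expR_ge0//=; lra.
  rewrite big_split/= ler_wpM2l ?prodr_ge0// -expR_sum ler_expR.
  under eq_bigr do rewrite exprMn mulrA.
  by rewrite -mulr_sumr rl ler_wpM2l// mulr_ge0// sqr_ge0.
rewrite -(ler_pM2r lm) -[leRHS]mulrA.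
apply: (@le_trans _ _ (2 ^+ b * ((2 * m)`!%:R * (2 * expR (2 * l ^+ 2 * B)))));
  last by rewrite ler_wpM2l// exprn_ge0.
rewrite mulr_suml.
apply: (@le_trans _ _ (\sum_(s : {ffun 'I_b -> bool}) (2 * m)`!%:R *
    (expR (l * \sum_(i < b) signed s i (x i)) +
     expR (- l * \sum_(i < b) signed s i (x i))))).
  apply: ler_sum => s _; rewrite mulrC -exprMn mulNr; exact: exprn_le_expR_sum.
rewrite -mulr_sumr big_split/= mulrCA ler_wpM2l// mulr2n mulrDl mul1r mulrDr.
by apply: lerD; apply: mgf; rewrite ?sqrrN.
Qed.

End Khinchine.

(** * Maximal correlation and comparison of sums with differences *)

Section MaximalCorrelation.
Context (d : measure_display) (T : measurableType d) (R : realType).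
Variable P : probability T R.
Implicit Types (f g A B : T -> R).

(** After scaling to mean 1, Bernoulli gives r^(2m) >= 1 + m (r^2 - 1) >= 1 + m (2r - 2), and the
    right side has mean 1. *)
Lemma jensen_exprn_even f m : bounded_wrt measurable f ->
  mean P f ^+ (2 * m) <= mean P (fun w => f w ^+ (2 * m)).
Proof.
move=> bf; set c := mean P f.
have [c0|c0] := eqVneq c 0.
  have : 0 <= mean P (fun w => f w ^+ (2 * m)).
    by apply: mean_ge0 => w; exact: exprn_even_ge0.
  rewrite c0 expr0n; case: eqP => [-> _|//].
  by under [X in mean _ X]eq_fun do rewrite expr0; rewrite mean_cst.
have cm : 0 < c ^+ (2 * m) by rewrite exprM exprn_gt0// exprn_even_gt0.
pose r w := c^-1 * f w.
have br : bounded_wrt measurable r by rewrite /r; bounded.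
have mr : mean P r = 1 by rewrite /r meanZ// -/c mulVf.
have -> : (fun w => f w ^+ (2 * m)) = (fun w => c ^+ (2 * m) * r w ^+ (2 * m)).
  by apply/funext => w; rewrite /r -exprMn mulrA divff// mul1r.
rewrite meanZ; last by bounded.
rewrite ler_peMr ?(ltW cm)//.
have -> : 1 = mean P (fun w => 1 + m%:R * (2 * r w - 2)).
  rewrite meanD; [|by bounded|by bounded].
  rewrite meanZ; last by bounded.
  rewrite meanB; [|by bounded|by bounded].
  by rewrite meanZ// !mean_cst mr mulr1 subrr mulr0 addr0.
apply: le_mean; [by bounded|by bounded|move=> w].
rewrite exprM; apply: le_trans (bernoulli_le _ (sqr_ge0 _)).
rewrite lerD2l ler_wpM2l//; have := sqr_ge0 (r w - 1); nra.
Qed.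

(** The left side is a polynomial in c. For odd m it is nonnegative at c = -M and nonpositive at c =
    M, where M bounds |A| and |B|, so the intermediate value theorem applies. *)
Lemma exists_center A B m : odd m ->
  bounded_wrt measurable A -> bounded_wrt measurable B ->
  exists c : R,
    mean P (fun w => (A w - c) ^+ m) + mean P (fun w => (B w - c) ^+ m) = 0.
Proof.
move=> om bA bB.
(* Binomial expansion of (f - c)^m in the indeterminate c, averaged coefficient by coefficient. *)
pose p f : {poly R} :=
  \poly_(i < m.+1) ((-1) ^+ i * mean P (fun w => f w ^+ (m - i)) *+ 'C(m, i)).
have pE f c : bounded_wrt measurable f ->
    (p f).[c] = mean P (fun w => (f w - c) ^+ m).
  move=> bf; rewrite horner_poly.
  have -> : (fun w => (f w - c) ^+ m) = (fun w => \sum_(i < m.+1)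
      ((-1) ^+ i * c ^+ i *+ 'C(m, i)) * f w ^+ (m - i)).
    apply/funext => w; rewrite exprBn; apply: eq_bigr => i _.
    by rewrite mulrnAl mulrAC.
  rewrite mean_sum => [|i _]; last by bounded.
  apply: eq_bigr => i _; rewrite meanZ; last by bounded.
  by rewrite !mulrnAl mulrAC.
have [_ [MA AM]] := bA; have [_ [MB BM]] := bB.
pose M := `|MA| + `|MB|.
have M0 : 0 <= M by rewrite addr_ge0.
have AM' w : `|A w| <= M.
  by have := AM w; have := ler_norm MA; have := normr_ge0 MB; rewrite /M; lra.
have BM' w : `|B w| <= M.
  by have := BM w; have := ler_norm MB; have := normr_ge0 MA; rewrite /M; lra.
have sgn (x : R) : (x <= 0 -> x ^+ m <= 0) /\ (0 <= x -> 0 <= x ^+ m).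
  split=> [x0|]; last exact: exprn_ge0.
  by rewrite exprn_odd_le0.
have lo f : bounded_wrt measurable f -> (forall w, `|f w| <= M) -> 0 <= (p f).[- M].
  move=> bf fM; rewrite pE//; apply: mean_ge0 => w.
  by apply: (sgn _).2; have := fM w; rewrite ler_norml => /andP[]; lra.
have hi f : bounded_wrt measurable f -> (forall w, `|f w| <= M) -> (p f).[M] <= 0.
  move=> bf fM; rewrite pE// -[leRHS](mean_cst P 0).
  apply: le_mean; [by bounded|by bounded|move=> w].
  by apply: (sgn _).1; have := fM w; rewrite ler_norml => /andP[]; lra.
have [||c _ /eqP] := @poly_ivt R (- (p A + p B)) (- M) M.
- by lra.
- rewrite !hornerN !hornerD oppr_le0 oppr_ge0.
  by rewrite addr_ge0 ?lo// -[leRHS]addr0 lerD ?hi.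
rewrite hornerN hornerD !pE// => /eqP; rewrite oppr_eq0 => /eqP c0.
by exists c.
Qed.

Definition cov_mean f g : R := mean P (fun w => f w * g w) - mean P f * mean P g.

(** Factors from [sum_moment_le_diff]: 16 from using [exprD_even_le] twice, 8 from absorbing the
    centred moments and the centre, 4 from [subrX_sqr_le]. *)
Definition split_cst : R := 16 * (8 * 4).

Lemma split_cst_ge1 : 1 <= split_cst.
Proof. by rewrite /split_cst -!natrM ler1n. Qed.

(** A consequence of correlation at most 1/2, as ab/2 <= (a^2 + b^2)/4, in a form free of division
    by variances. *)
Definition weakly_correlated f g : Prop :=
  `|cov_mean f g| <= (cov_mean f f + cov_mean g g) / 4.

(** With f = (A - c)^m and g = (B - c)^m, weak correlation bounds E (f - g)^2 below by half of W = E
    f^2 + E g^2, while [subrX_sqr_le] bounds it above by W/4 plus a multiple of E (A - B)^(2m).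
    Hence W is controlled, and so is A + B. *)
Lemma sum_moment_le_diff A B m : odd m ->
  bounded_wrt measurable A -> bounded_wrt measurable B ->
  mean P A = 0 -> mean P B = 0 ->
  (forall c, weakly_correlated (fun w => (A w - c) ^+ m) (fun w => (B w - c) ^+ m)) ->
  mean P (fun w => (A w + B w) ^+ (2 * m)) <=
    (split_cst * m%:R ^+ 2) ^+ m * mean P (fun w => (A w - B w) ^+ (2 * m)).
Proof.
move=> om bA bB A0 B0 wc; have m0 := odd_gt0 om.
have [c c0] := exists_center om bA bB.
have {wc} := wc c; rewrite /weakly_correlated /cov_mean.
pose A' w := A w - c; pose B' w := B w - c.
have bA' : bounded_wrt measurable A' by rewrite /A'; bounded.
have bB' : bounded_wrt measurable B' by rewrite /B'; bounded.
pose f w := A' w ^+ m; pose g w := B' w ^+ m.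
have bf : bounded_wrt measurable f by rewrite /f; bounded.
have bg : bounded_wrt measurable g by rewrite /g; bounded.
rewrite -/f -/g; rewrite -/f -/g in c0.
pose WA := mean P (fun w => A' w ^+ (2 * m)).
pose WB := mean P (fun w => B' w ^+ (2 * m)).
pose D := mean P (fun w => (A w - B w) ^+ (2 * m)).
have -> : mean P (fun w => f w * f w) = WA.
  by congr mean; apply/funext => w; rewrite /f -expr2 -exprM mulnC.
have -> : mean P (fun w => g w * g w) = WB.
  by congr mean; apply/funext => w; rewrite /g -expr2 -exprM mulnC.
set u := mean P f in c0 *; have -> : mean P g = - u by lra.
set X := mean P (fun w => f w * g w) => wc.
have fg : mean P (fun w => (f w - g w) ^+ 2) = WA + WB - 2 * X.
  have -> : (fun w => (f w - g w) ^+ 2) =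
      (fun w => A' w ^+ (2 * m) + B' w ^+ (2 * m) - 2 * (f w * g w)).
    by apply/funext => w; rewrite /f /g !(mulnC 2) !exprM; ring.
  rewrite meanB; [|by bounded|by bounded].
  rewrite meanD; [|by bounded|by bounded].
  by rewrite meanZ//; bounded.
(* The means of [f] and [g] are u and -u, so the product of means enters the covariance with the
   favourable sign. *)
have fg_ge : (WA + WB) / 2 <= mean P (fun w => (f w - g w) ^+ 2).
  rewrite fg; move: wc; rewrite ler_norml => /andP[_].
  by have := sqr_ge0 u; nra.
have fg_le : mean P (fun w => (f w - g w) ^+ 2) <=
    (WA + WB) / 4 + (4 * m%:R ^+ 2) ^+ m * D.
  have -> : (WA + WB) / 4 + (4 * m%:R ^+ 2) ^+ m * D = mean P (fun w =>
      4^-1 * (A' w ^+ (2 * m) + B' w ^+ (2 * m)) +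
      (4 * m%:R ^+ 2) ^+ m * (A w - B w) ^+ (2 * m)).
    rewrite meanD; [|by bounded|by bounded].
    rewrite !meanZ; [|by bounded|by bounded].
    rewrite meanD; [|by bounded|by bounded].
    by rewrite [4^-1 * _]mulrC.
  apply: le_mean; [by bounded|by bounded|move=> w].
  apply: (le_trans (subrX_sqr_le _ _ m0)).
  have -> : A' w - B' w = A w - B w by rewrite /A' /B'; ring.
  by rewrite [X in X + _]mulrC [in X in _ + X]exprMn -exprM.
have W_le : WA + WB <= 4 * ((4 * m%:R ^+ 2) ^+ m * D) by lra.
have WB0 : 0 <= WB by apply: mean_ge0 => w; exact: exprn_even_ge0.
have D0 : 0 <= D by apply: mean_ge0 => w; exact: exprn_even_ge0.
(* [A] has mean zero, so [A - c] has mean -c and Jensen bounds the unknown centre. *)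
have cWA : c ^+ (2 * m) <= WA.
  have := jensen_exprn_even m bA'; rewrite {1}/A' meanB//; last by bounded.
  rewrite mean_cst A0 sub0r => h; apply: le_trans h.
  by rewrite [leRHS]exprn_even_norm normrN -exprn_even_norm.
apply: (@le_trans _ _ (16 ^+ m * (2 * (WA + WB)))).
  apply: (@le_trans _ _ (16 ^+ m * (WA + WB + c ^+ (2 * m)))); last first.
    rewrite ler_wpM2l ?exprn_ge0//; lra.
  have -> : 16 ^+ m * (WA + WB + c ^+ (2 * m)) = mean P (fun w =>
      16 ^+ m * (A' w ^+ (2 * m) + B' w ^+ (2 * m) + c ^+ (2 * m))).
    rewrite meanZ; last by bounded.
    rewrite meanD; [|by bounded|by bounded].
    rewrite meanD; [|by bounded|by bounded].
    by rewrite mean_cst.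
  apply: le_mean; [by bounded|by bounded|move=> w].
  have -> : A w + B w = (A' w + B' w) + (2 * c) by rewrite /A' /B'; ring.
  apply: (le_trans (exprD_even_le _ _ _)).
  have -> : 16 ^+ m = 4 ^+ m * 4 ^+ m :> R by rewrite -exprMn -natrM.
  rewrite -mulrA ler_wpM2l ?exprn_ge0// mulrDr lerD ?exprD_even_le//.
  by rewrite exprMn exprM (_ : 2 ^+ 2 = 4)//; ring.
apply: (@le_trans _ _ (16 ^+ m * (8 * ((4 * m%:R ^+ 2) ^+ m * D)))).
  rewrite ler_wpM2l ?exprn_ge0//; lra.
have -> : split_cst * m%:R ^+ 2 = 16 * (8 * (4 * m%:R ^+ 2)).
  by rewrite /split_cst -!mulrA.
rewrite !exprMn -!mulrA ler_wpM2l ?exprn_ge0// -/D.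
rewrite ler_wpM2r ?mulr_ge0 ?exprn_ge0//.
by rewrite -{1}[8]expr1 ler_weXn2l// ler1n.
Qed.

Lemma cov_fine f g : bounded_wrt measurable f -> bounded_wrt measurable g ->
  (covariance P f g = (cov_mean f g)%:E)%E.
Proof.
move=> bf bg; have bfg : bounded_wrt measurable (f * g).
  exact: (bounded_wrtM (sigma_algebra_measurable T) bf bg).
rewrite covarianceE; first last.
- by apply: bounded_Lfun.
- by apply: bounded_Lfun.
- by apply: bounded_Lfun.
by rewrite !mean_expectation.
Qed.

Lemma abs_covariance_le f g : f \in Lfun P 2%:E -> g \in Lfun P 2%:E ->
  `|fine (covariance P f g)| <=
    Num.sqrt (fine 'V_P[f]%E) * Num.sqrt (fine 'V_P[g]%E).
Proof.
move=> f2 g2.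
have Pfin : P setT \is a fin_num := fin_num_measure P _ measurableT.
have f1 := Lfun_subset12 Pfin f2.
have g1 := Lfun_subset12 Pfin g2.
have fg1 := Lfun2_mul_Lfun1 f2 g2.
have cf := covariance_fin_num f1 g1 fg1.
have le h : h \in Lfun P 2%:E -> (covariance P h g \is a fin_num) ->
    fine (covariance P h g) <= Num.sqrt (fine 'V_P[h]%E) * Num.sqrt (fine 'V_P[g]%E).
  move=> h2 ch; rewrite -lee_fin fineK//.
  apply: (le_trans (covariance_le h2 g2)).
  rewrite -{1}(fineK (variance_fin_num h2)) -{1}(fineK (variance_fin_num g2)).
  by rewrite EFinM.
rewrite ler_norml le// andbT lerNl -fineN -covarianceNl//.
rewrite -(varianceN f2); apply: le; first by rewrite rpredN.
by rewrite covarianceNl// fin_numN.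
Qed.

(** Cauchy-Schwarz; for a zero denominator the quotient is 0 by convention. This makes the set
    defining [rho] bounded, so that its [sup] is an upper bound. *)
Lemma abs_corr_le1 f g : f \in Lfun P 2%:E -> g \in Lfun P 2%:E ->
  `|corr P f g| <= 1.
Proof.
move=> f2 g2; rewrite /corr normrM normfV.
have := abs_covariance_le f2 g2.
set D := _ * _; have D0 : 0 <= D by rewrite mulr_ge0 ?sqrtr_ge0.
rewrite (ger0_norm D0); have [->|Dn0 h] := eqVneq D 0; first by rewrite invr0 mulr0.
by rewrite ler_pdivrMr ?mul1r// lt_neqAle eq_sym Dn0.
Qed.

Lemma abs_corr_le_rho G1 G2 f g :
  measurable_wrt G1 f -> measurable_wrt G2 g ->
  f \in Lfun P 2%:E -> g \in Lfun P 2%:E ->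
  ('V_P[f] != 0)%E -> ('V_P[g] != 0)%E -> `|corr P f g| <= rho P G1 G2.
Proof.
move=> mf mg f2 g2 vf vg; apply: ub_le_sup.
  by exists 1 => _ [h1 [h2 [_ [l1 l2] _ ->]]]; exact: abs_corr_le1.
by exists f, g; split.
Qed.

Lemma rho_le1 G1 G2 : rho P G1 G2 <= 1.
Proof.
rewrite /rho; set S := (X in sup X).
have [->|/set0P S0] := eqVneq S set0; first by rewrite sup0.
by apply: ge_sup => // _ [h1 [h2 [_ [l1 l2] _ ->]]]; exact: abs_corr_le1.
Qed.

Lemma rho_le_rho_star (X : nat -> T -> R) n (S S' : set nat) :
  S `<=` pos_index -> S' `<=` pos_index -> S !=set0 -> S' !=set0 ->
  (forall s t, S s -> S' t -> (n <= `|s%:Z - t%:Z|)%N) ->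
  rho P (sigma_gen X S) (sigma_gen X S') <= rho_star P X n.
Proof.
move=> Sp S'p S0 S'0 SS'; apply: ub_le_sup.
  by exists 1 => _ [s [s' [_ _ _ ->]]]; exact: rho_le1.
by exists S, S'; split.
Qed.

Lemma weakly_correlated_rho (G1 G2 : set (set T)) f g :
  G1 `<=` measurable -> G2 `<=` measurable ->
  bounded_wrt G1 f -> bounded_wrt G2 g ->
  rho P G1 G2 <= 1 / 2 -> weakly_correlated f g.
Proof.
move=> G1m G2m bf bg r2.
have bf' := bounded_wrtS G1m bf; have bg' := bounded_wrtS G2m bg.
have f2 : f \in Lfun P 2%:E by apply: bounded_Lfun => //; rewrite ler1n.
have g2 : g \in Lfun P 2%:E by apply: bounded_Lfun => //; rewrite ler1n.
rewrite /weakly_correlated.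
have Vf : ('V_P[f] = (cov_mean f f)%:E)%E by rewrite /variance cov_fine.
have Vg : ('V_P[g] = (cov_mean g g)%:E)%E by rewrite /variance cov_fine.
have vf0 : 0 <= cov_mean f f by rewrite -lee_fin -Vf variance_ge0.
have vg0 : 0 <= cov_mean g g by rewrite -lee_fin -Vg variance_ge0.
have := abs_covariance_le f2 g2; rewrite cov_fine// Vf Vg /= => cs.
set a := Num.sqrt (cov_mean f f) in cs *; set b := Num.sqrt (cov_mean g g) in cs *.
have aE : cov_mean f f = a ^+ 2 by rewrite sqr_sqrtr.
have bE : cov_mean g g = b ^+ 2 by rewrite sqr_sqrtr.
have a0 : 0 <= a by exact: sqrtr_ge0.
have b0 : 0 <= b by exact: sqrtr_ge0.
suff h : `|cov_mean f g| <= (a * b) / 2.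
  by apply: (le_trans h); rewrite aE bE; have := sqr_ge0 (a - b); nra.
(* Functions of zero variance do not enter the supremum [rho], but for them Cauchy-Schwarz makes the
   covariance vanish. *)
have [af|af] := eqVneq a 0; first by move: cs; rewrite af mul0r; lra.
have [bf0|bf0] := eqVneq b 0; first by move: cs; rewrite bf0 mulr0; lra.
have := @abs_corr_le_rho G1 G2 f g bf.1 bg.1 f2 g2.
rewrite Vf Vg !eqe aE bE !sqrf_eq0 => /(_ af bf0).
rewrite /corr cov_fine// Vf Vg /= -/a -/b normrM normfV.
have ab0 : 0 < a * b by rewrite mulr_gt0// lt_neqAle eq_sym ?af ?bf0.
rewrite (ger0_norm (ltW ab0)) => /le_trans/(_ r2).
by rewrite ler_pdivrMr//; lra.
Qed.

End MaximalCorrelation.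

(** * Moments of sums of mixing variables *)

Section MixingMoments.
Context (d : measure_display) (T : measurableType d) (R : realType).
Variable P : probability T R.
Variables (X Y : nat -> T -> R) (C : R) (n0 : nat).
Hypothesis mX : forall k, measurable_fun setT (X k).
Hypothesis bY : forall k, bounded_wrt (sigma_gen X [set k]) (Y k).
Hypotheses (C_gt0 : 0 < C) (YC : forall k w, `|Y k w| <= C).
Hypothesis Y_mean : forall k, (0 < k)%N -> mean P (Y k) = 0.
Hypotheses (n0_gt0 : (0 < n0)%N) (rho_n0 : rho_star P X n0 <= 1 / 2).

Lemma sigma_gen_sub S : sub_sigma_algebra_of (sigma_gen X S).
Proof.
split; first exact: smallest_sigma_algebra.
apply: smallest_sub; first exact: sigma_algebra_measurable.
move=> _ [k _ [B mB <-]]; exact: mX.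
Qed.

Lemma sigma_genS S S' : S `<=` S' -> sigma_gen X S `<=` sigma_gen X S'.
Proof. by move=> SS'; apply: sub_sigma_algebra2; exact: bigcup_subset. Qed.

Let bYm k : bounded_wrt measurable (Y k).
Proof. by apply: bounded_wrtS (bY k); exact: (sigma_gen_sub _).2. Qed.

Lemma mod_eq_dist i j : i != j -> i = j %[mod n0] ->
  (n0 <= `|i%:Z - j%:Z|)%N.
Proof.
wlog ij : i j / (i <= j)%N.
  move=> H; have [/H//|/ltnW/H] := leqP i j; rewrite eq_sym distnC.
  by move=> h /h{}h /esym.
move=> nij /eqP; rewrite eq_sym (eqn_mod_dvd _ ij) => /dvdn_leq.
rewrite subn_gt0 ltn_neqAle nij ij => /(_ isT) /leq_trans; apply.
by rewrite distnC distnEl.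
Qed.

(** Distinct indices of one residue class modulo [n0] are at distance at least [n0], so any
    splitting [s] of the support yields two weakly correlated parts; flipping the sign of one part
    is then affordable. *)
Lemma split_moment_le (a : nat -> R) b (s : {ffun 'I_b -> bool}) m r :
  a 0%N = 0 -> (forall k, a k != 0 -> (k %% n0)%N = r) -> odd m ->
  mean P (fun w => (\sum_(k < b) a k * Y k w) ^+ (2 * m)) <=
  (split_cst R * m%:R ^+ 2) ^+ m *
    mean P (fun w => (\sum_(k < b) signed s k (a k * Y k w)) ^+ (2 * m)).
Proof.
move=> a0 ar om; have m0 := odd_gt0 om.
(* Only indices with nonzero coefficient are kept: these are positive and lie in the residue
   class. *)
pose S (e : bool) : set nat :=
  [set k : nat | exists i : 'I_b, [/\ s i = e, k = i & a i != 0]].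
pose A (e : bool) w := \sum_(k < b | s k == e) a k * Y k w.
have bA e : bounded_wrt (sigma_gen X (S e)) (A e).
  apply: bounded_wrt_sum => [|i /eqP si]; first exact: (sigma_gen_sub _).1.
  have [ai|ai] := eqVneq (a i) 0.
    under eq_fun do rewrite ai mul0r.
    by apply: bounded_wrt_cst; exact: (sigma_gen_sub _).1.
  apply: bounded_wrtM; first exact: (sigma_gen_sub _).1.
    by apply: bounded_wrt_cst; exact: (sigma_gen_sub _).1.
  by apply: bounded_wrtS (bY i); apply: sigma_genS => _ ->; exists i.
have bAm e : bounded_wrt measurable (A e).
  by apply: bounded_wrtS (bA e); exact: (sigma_gen_sub _).2.
have SE w : \sum_(k < b) a k * Y k w = A true w + A false w.
  rewrite (bigID (fun k : 'I_b => s k))/=; congr (_ + _); apply: eq_bigl => k.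
    by rewrite eqb_id.
  by rewrite eqbF_neg.
have DE w : \sum_(k < b) signed s k (a k * Y k w) = A true w - A false w.
  rewrite (bigID (fun k : 'I_b => s k))/= /A -sumrN; congr (_ + _).
    apply: eq_big => [k|k sk]; first by rewrite eqb_id.
    by rewrite /signed sk.
  apply: eq_big => [k|k /negbTE sk]; first by rewrite eqbF_neg.
  by rewrite /signed sk.
under [X in mean _ X <= _]eq_fun do rewrite SE.
under [X in _ <= _ * mean _ X]eq_fun do rewrite DE.
have K1 : 1 <= (split_cst R * m%:R ^+ 2) ^+ m :> R.
  have s1 := split_cst_ge1 R; rewrite exprn_ege1//.
  apply: (le_trans s1); rewrite ler_peMr ?(le_trans ler01 s1)//.
  by rewrite exprn_ege1// ler1n.
have AS0 e : S e = set0 -> A e = (fun=> 0).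
  move=> Se; apply/funext => w; apply: big1 => i /eqP si.
  have [->|ai] := eqVneq (a i) 0; first by rewrite mul0r.
  by have : S e i by [exists i]; rewrite Se.
(* [rho_star] ranges over nonempty index sets. If one part is empty, sum and difference agree up to
   sign. *)
have triv e : S e = set0 ->
    mean P (fun w => (A true w + A false w) ^+ (2 * m)) <=
    (split_cst R * m%:R ^+ 2) ^+ m *
      mean P (fun w => (A true w - A false w) ^+ (2 * m)).
  move=> /AS0 Ae.
  have -> : (fun w => (A true w + A false w) ^+ (2 * m)) =
      (fun w => (A true w - A false w) ^+ (2 * m)).
    apply/funext => w; case: e Ae => ->; last by rewrite subr0 addr0.
    by rewrite sub0r add0r [RHS]exprn_even_norm normrN -exprn_even_norm.
  by rewrite ler_peMl// mean_ge0// => w; exact: exprn_even_ge0.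
have [/triv//|/set0P St] := eqVneq (S true) set0.
have [/triv//|/set0P Sf] := eqVneq (S false) set0.
have Spos e : S e `<=` pos_index.
  move=> _ [i [_ -> ai]]; rewrite /pos_index /= lt0n.
  by apply: contra ai => /eqP ->; rewrite a0.
have rho2 : rho P (sigma_gen X (S true)) (sigma_gen X (S false)) <= 1 / 2.
  apply: le_trans rho_n0; apply: rho_le_rho_star => //.
  move=> _ _ [i [si -> ai]] [j [sj -> aj]]; apply: mod_eq_dist.
    by apply/eqP => ij; move: si; rewrite (ord_inj ij) sj.
  by rewrite (ar _ ai) (ar _ aj).
have A0 e : mean P (A e) = 0.
  rewrite /A mean_sum => [|i _]; last by bounded.
  apply: big1 => i _; rewrite meanZ//.
  have [->|ai] := eqVneq (a i) 0; first by rewrite mul0r.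
  by rewrite Y_mean ?mulr0// lt0n; apply: contra ai => /eqP ->; rewrite a0.
apply: sum_moment_le_diff => // c.
apply: (weakly_correlated_rho _ _ _ _ rho2); try exact: (sigma_gen_sub _).2.
- apply: bounded_wrtX; first exact: (sigma_gen_sub _).1.
  apply: bounded_wrtD => //; first exact: (sigma_gen_sub _).1.
  by apply: bounded_wrt_cst; exact: (sigma_gen_sub _).1.
- apply: bounded_wrtX; first exact: (sigma_gen_sub _).1.
  apply: bounded_wrtD => //; first exact: (sigma_gen_sub _).1.
  by apply: bounded_wrt_cst; exact: (sigma_gen_sub _).1.
Qed.

(** Averages [split_moment_le] over all splittings: the left side does not depend on [s], and on the
    right Khinchine applies pointwise in [w]. The powers m^2 and m combine to m^3. *)
Lemma residue_moment_le (a : nat -> R) b V m r :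
  a 0%N = 0 -> (forall k, a k != 0 -> (k %% n0)%N = r) ->
  0 < V -> \sum_(k < b) a k ^+ 2 <= V -> odd m ->
  mean P (fun w => (\sum_(k < b) a k * Y k w) ^+ (2 * m)) <=
    (split_cst R * moment_cst R * C ^+ 2 * m%:R ^+ 3 * V) ^+ m.
Proof.
move=> a0 ar V0 aV om; have m0 := odd_gt0 om.
have B0 : 0 < C ^+ 2 * V by rewrite mulr_gt0 ?exprn_gt0.
set L := mean P _; pose Q : R := (split_cst R * m%:R ^+ 2) ^+ m.
have s0 : 0 <= split_cst R := le_trans ler01 (split_cst_ge1 R).
have Q0 : 0 <= Q by rewrite exprn_ge0// mulr_ge0// exprn_ge0.
pose D (s : {ffun 'I_b -> bool}) w := \sum_(k < b) signed s k (a k * Y k w).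
have bD s : bounded_wrt measurable (D s).
  rewrite /D; apply: bounded_wrt_sum => [|i _]; first exact: sigma_algebra_measurable.
  by rewrite /signed; case: (s i); bounded; exact: bYm.
have c2 : 0 < 2 ^+ b :> R by exact: exprn_gt0.
rewrite -(ler_pM2l c2).
have -> : 2 ^+ b * L = \sum_(s : {ffun 'I_b -> bool}) L.
  by rewrite sumr_const card_ffun card_bool card_ord -natrX mulr_natl.
apply: (@le_trans _ _ (\sum_(s : {ffun 'I_b -> bool})
    Q * mean P (fun w => D s w ^+ (2 * m)))).
  by apply: ler_sum => s _; exact: split_moment_le a0 ar om.
rewrite -mulr_sumr -mean_sum => [|s _]; last by bounded; exact: bD.
have -> : 2 ^+ b * (split_cst R * moment_cst R * C ^+ 2 * m%:R ^+ 3 * V) ^+ m =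
    Q * (2 ^+ b * (moment_cst R * m%:R * (C ^+ 2 * V)) ^+ m).
  rewrite /Q [RHS]mulrCA; congr (_ * _); rewrite -exprMn; congr (_ ^+ _); ring.
rewrite ler_wpM2l// -[leRHS](mean_cst P).
apply: le_mean; [by bounded; exact: bD|by bounded|move=> w].
apply: khinchine => //.
apply: (@le_trans _ _ (\sum_(k < b) C ^+ 2 * a k ^+ 2)).
  apply: ler_sum => k _; rewrite exprMn mulrC ler_wpM2r ?sqr_ge0//.
  by rewrite -(real_normK (num_real (Y k w))) lerXn2r ?nnegrE// ltW.
by rewrite -mulr_sumr ler_wpM2l// ltW// exprn_gt0.
Qed.

(** The power of a sum over [n0] classes costs n0^(2m), and adding the [n0] moments costs n0 <=
    n0^m; hence n0^3 in the constant. *)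
Lemma mixing_moment_bound : moment_bound P Y 3.
Proof.
pose K : R := split_cst R * moment_cst R * C ^+ 2.
have s0 : 0 < split_cst R := lt_le_trans ltr01 (split_cst_ge1 R).
have K0 : 0 < K by rewrite mulr_gt0 ?exprn_gt0// mulr_gt0// moment_cst_gt0.
have n0R : 1 <= n0%:R :> R by rewrite ler1n.
exists (n0%:R ^+ 3 * K) => [|b a V m a0 V0 aV om].
  by rewrite mulr_gt0// exprn_gt0// ltr0n.
have m0 := odd_gt0 om.
pose ar (r k : nat) := if (k %% n0 == r)%N then a k else 0.
pose S (r : 'I_n0) w := \sum_(k < b) ar r k * Y k w.
have bS r : bounded_wrt measurable (S r) by rewrite /S; bounded; exact: bYm.
have SE w : \sum_(k < b) a k * Y k w = \sum_(r < n0) S r w.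
  rewrite /S exchange_big/=; apply: eq_bigr => k _.
  rewrite -mulr_suml; congr (_ * _).
  have kn : (k %% n0 < n0)%N by rewrite ltn_mod.
  rewrite (bigD1 (Ordinal kn))//= /ar eqxx big1 ?addr0// => i.
  by rewrite -val_eqE/= eq_sym => /negbTE ->.
have Sr r : mean P (fun w => S r w ^+ (2 * m)) <= (K * m%:R ^+ 3 * V) ^+ m.
  apply: (@residue_moment_le (ar r) b V m r) => //.
  - by rewrite /ar a0; case: ifP.
  - by move=> k; rewrite /ar; case: ifP => [/eqP//|]; rewrite eqxx.
  - apply: le_trans aV; apply: ler_sum => k _; rewrite /ar.
    by case: ifP => // _; rewrite expr0n sqr_ge0.
apply: (@le_trans _ _ (mean P (fun w =>
    n0%:R ^+ (2 * m) * \sum_(r < n0) S r w ^+ (2 * m)))).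
  apply: le_mean; [by bounded; exact: bYm|by bounded; exact: bS|move=> w].
  by rewrite SE; exact: sum_exprn_even_le.
rewrite meanZ; last by bounded; exact: bS.
rewrite mean_sum => [|r _]; last by bounded; exact: bS.
apply: (@le_trans _ _ (n0%:R ^+ (2 * m) * (n0%:R * (K * m%:R ^+ 3 * V) ^+ m))).
  rewrite ler_wpM2l ?exprn_ge0//.
  rewrite -[n0 in leRHS]card_ord mulr_natl -sumr_const.
  by apply: ler_sum => r _; exact: Sr.
have -> : n0%:R ^+ 3 * K * m%:R ^+ 3 * V = n0%:R ^+ 2 * (n0%:R * (K * m%:R ^+ 3 * V)).
  by ring.
rewrite exprM [leRHS]exprMn [X in _ <= _ * X]exprMn.
rewrite ler_wpM2l ?exprn_ge0// ler_wpM2r//.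
  by rewrite exprn_ge0// !mulr_ge0// ltW.
by rewrite -{1}[n0%:R]expr1 ler_weXn2l.
Qed.

End MixingMoments.

(** * Reduction to bounded variables *)

Section Reduction.
Context (d : measure_display) (T : measurableType d) (R : realType).
Variable P : probability T R.

(** The bound on [X k] holds only almost surely. Clipping makes it hold everywhere, and being Borel
    it preserves measurability for the sigma-algebra of [X k]. *)
Definition clip (C y : R) : R := Num.max (- C) (Num.min C y).

Lemma norm_clip_le C y : 0 <= C -> `|clip C y| <= C.
Proof.
by move=> C0; rewrite /clip ler_norml le_max lexx/= ge_max ge_min lexx/= andbT; lra.
Qed.

Lemma clip_id C y : `|y| <= C -> clip C y = y.
Proof.
by rewrite ler_norml => /andP[yC Cy]; rewrite /clip min_r// max_r.
Qed.

Lemma measurable_clip C : measurable_fun setT (clip C).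
Proof.
apply: measurable_maxr; first exact: measurable_cst.
by apply: measurable_minr; [exact: measurable_cst|exact: measurable_id].
Qed.

Lemma bounded_wrt_clip (G : set (set T)) C (f : T -> R) : 0 <= C ->
  measurable_wrt G f -> bounded_wrt G (fun w => clip C (f w)).
Proof.
move=> C0 mf; split; last by exists C => w; exact: norm_clip_le.
move=> B mB; apply: (mf (clip C @^-1` B)).
by rewrite -[_ @^-1` _]setTI; exact: measurable_clip.
Qed.

Lemma Rintegral_ae_eq (A : set T) (f g : T -> R) : measurable A ->
  measurable_fun setT f -> measurable_fun setT g ->
  {ae P, forall w, f w = g w} -> \int[P]_(w in A) f w = \int[P]_(w in A) g w.
Proof.
move=> mA mf mg fg; congr fine; apply: ae_eq_integral => //.
- by apply/measurable_EFinP; exact: measurable_funTS.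
- by apply/measurable_EFinP; exact: measurable_funTS.
- by apply: filterS fg => w /= -> _.
Qed.

Section Independence.
Variables (X : nat -> T -> R) (C : R).
Hypothesis mX : forall k, measurable_fun setT (X k).
Hypothesis indX : mutually_independent P X.

Definition past (k : nat) : set nat := [set i | (0 < i <= k)%N].

(** An intersection-stable family generating the sigma-algebra of the past, as the Dynkin argument
    requires. *)
Definition cylinder (k : nat) : set (set T) :=
  [set A | exists B : nat -> set R, (forall i, measurable (B i)) /\
           A = \bigcap_(i in past k) X i @^-1` B i].

Lemma cylinder_setI k : setI_closed (cylinder k).
Proof.
move=> _ _ [B [mB ->]] [B' [mB' ->]]; exists (fun i => B i `&` B' i); split.
  by move=> i; exact: measurableI.
rewrite -bigcapI; apply: eq_bigcapr => i _; exact: preimage_setI.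
Qed.

Lemma sigma_gen_past k : sigma_gen X (past k) `<=` <<s cylinder k >>.
Proof.
apply: sub_sigma_algebra2 => _ [i ki [B mB <-]].
exists (fun j => if j == i then B else setT); split.
  by move=> j; case: ifP.
rewrite setTI; apply/seteqP; split => [w Bw j _ /=|w /(_ i ki)].
  by case: eqP => [->|].
by rewrite /= eqxx.
Qed.

(** Compares the product formulas for the index sets {1, ..., k} and {1, ..., k+1}. *)
Lemma cylinder_indep k A B : cylinder k A -> measurable B ->
  (P (A `&` X k.+1 @^-1` B) = P A * P (X k.+1 @^-1` B))%E.
Proof.
move=> [D [mD ->]] mB.
pose J : {fset nat} := [fset i in iota 1 k]%fset.
have JP i : (i \in J) = (0 < i <= k)%N.
  by rewrite !inE mem_iota add1n ltnS.
have JE (Z : nat -> set T) : \bigcap_(i in [set` J]) Z i = \bigcap_(i in past k) Z i.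
  by have -> : [set` J] = past k by apply/seteqP; split => i /=; rewrite JP.
have kJ : k.+1 \notin J by rewrite JP ltnn andbF.
pose D' i := if i == k.+1 then B else D i.
have D'D i : i \in J -> D' i = D i.
  by rewrite /D' JP; case: eqP => // -> /andP[_]; rewrite ltnn.
have h1 := indX (B := D) (J := J) _ _.
have h2 := indX (B := D') (J := (k.+1 |` J)%fset) _ _.
rewrite JE in h1.
have -> : \bigcap_(i in past k) X i @^-1` D i `&` X k.+1 @^-1` B =
    \bigcap_(i in [set` (k.+1 |` J)%fset]) X i @^-1` D' i.
  apply/seteqP; split => w /=.
    move=> [wD wB] i /=; rewrite in_fset1U => /orP[/eqP ->|iJ].
      by rewrite /D' eqxx.
    by rewrite D'D//; apply: wD; rewrite /past /= -JP.
  move=> wD'; split.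
    move=> i ik; have iJ : i \in J by rewrite JP.
    by have := wD' i; rewrite /= in_fset1U iJ orbT D'D//; exact.
  by have := wD' k.+1; rewrite /= in_fset1U eqxx /D' eqxx; exact.
rewrite h2; last first.
- by move=> i _; rewrite /D'; case: ifP.
- by move=> i; rewrite in_fset1U JP => /orP[/eqP -> //|/andP[]].
rewrite big_fsetU1//= h1; last first.
- by move=> i _; exact: mD.
- by move=> i; rewrite JP => /andP[].
have -> : D' k.+1 = B by rewrite /D' eqxx.
rewrite muleC; congr (_ * _)%E.
rewrite big_seq [RHS]big_seq; apply: eq_bigr => i iJ; by rewrite D'D.
Qed.

(** The events over which the integral vanishes form a Dynkin system; by independence it contains
    the cylinders, hence the sigma-algebra they generate. *)
Lemma independent_integral_past k A : 0 <= C ->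
  (mean P (fun w => clip C (X k.+1 w)) = 0) ->
  sigma_gen X (past k) A -> \int[P]_(w in A) clip C (X k.+1 w) = 0.
Proof.
move=> C0 f0; set f := fun w => clip C (X k.+1 w).
have bf : bounded_wrt measurable f.
  by apply: bounded_wrt_clip => //; apply/measurable_wrt_measurable.
have intf : P.-integrable setT (EFin \o f) by exact: bounded_integrable.
have intfA B : measurable B -> P.-integrable B (EFin \o f).
  by move=> mB; apply: integrableS intf.
have cylm B : cylinder k B -> measurable B.
  move=> [D [mD ->]]; have -> : \bigcap_(i in past k) X i @^-1` D i =
      \bigcap_i (if (0 < i <= k)%N then X i @^-1` D i else setT).
    apply/seteqP; split => w wD i; rewrite ?/past /=.
      by move=> _; case: ifPn => // ik; exact: wD.
    by move=> ik; have := wD i I; rewrite ik.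
  apply: bigcapT_measurable => i; case: ifP => // _.
  by rewrite -[_ @^-1` _]setTI; exact: mX.
have zE B : measurable B ->
    (\int[P]_(w in B) (f w)%:E)%E = (\int[P]_(w in B) f w)%:E.
  by move=> mB; rewrite fineK// integrable_fin_num//; exact: intfA.
pose H : set (set T) := [set B | measurable B /\ \int[P]_(w in B) f w = 0].
have dH : dynkin H.
  split.
  - by split.
  - move=> B [mB B0]; split; first exact: measurableC.
    have := @Rintegral_setU _ _ _ P B (~` B) f mB (measurableC mB).
    rewrite setUv => /(_ intf); rewrite B0 add0r => <-; first exact: f0.
    by apply/disj_setPS; rewrite setICr.
  - move=> F tF FH; split; first by apply: bigcup_measurable => i _; have [] := FH i.
    rewrite /Rintegral integral_bigcup//; last 2 first.
    + by move=> i; have [] := FH i.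
    + by apply: intfA; apply: bigcup_measurable => i _; have [] := FH i.
    by rewrite eseries0// => i _ _; have [mFi Fi0] := FH i; rewrite /= zE// Fi0.
have cH : cylinder k `<=` H.
  move=> B cB; have mB := cylm _ cB; split => //.
  pose G := preimage_set_system setT (X k.+1) (@measurable _ R).
  have sG : sub_sigma_algebra_of G.
    split; first by apply: sigma_algebra_preimage; exact: sigma_algebra_measurable.
    by move=> _ [D mD <-]; exact: mX.
  have mG : measurable_wrt G (X k.+1) by move=> D mD; exists D => //; rewrite setTI.
  pose p := fine (P B).
  have bB : bounded_wrt measurable (\1_B : T -> R).
    split; first by apply/measurable_wrt_measurable; exact: measurable_indic.
    by exists 1 => w; rewrite indicE; case: (_ \in _); rewrite ?normr1 ?normr0.
  have PB : (P B = p%:E)%E by rewrite /p fineK// fin_num_measure.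
  have bBp : bounded_wrt measurable (fun w => \1_B w - p) by bounded.
  (* Here [f] is the factor measurable for the sub-sigma-algebra, that of [X k.+1], and the centred
     indicator of [B] integrates to zero over its events. *)
  have h : mean P (fun w => f w * (\1_B w - p)) = 0.
    apply: (mean_mul_eq0 sG (bounded_wrt_clip C0 mG) bBp).
    move=> _ [D mD <-]; rewrite setTI.
    have mXD : measurable (X k.+1 @^-1` D) by rewrite -[_ @^-1` _]setTI; exact: mX.
    rewrite RintegralB//; last 2 first.
    + by apply: integrableS (bounded_integrable P bB).
    + apply: integrableS (bounded_integrable P (bounded_wrt_cst _ p)) => //.
      exact: sigma_algebra_measurable.
    have -> : \int[P]_(w in X k.+1 @^-1` D) \1_B w = fine (P (B `&` X k.+1 @^-1` D)).
      by rewrite /Rintegral integral_indic.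
    have -> : \int[P]_(w in X k.+1 @^-1` D) p = p * fine (P (X k.+1 @^-1` D)).
      exact: Rintegral_cst.
    by rewrite cylinder_indep// PB fineM ?fin_num_measure//= subrr.
  have -> : \int[P]_(w in B) f w = mean P (fun w => f w * \1_B w).
    rewrite Rintegral_mkcond; apply: eq_Rintegral => w _.
    by rewrite patchE indicE; case: ifP; rewrite ?mulr1 ?mulr0.
  have -> : (fun w => f w * \1_B w) = (fun w => f w * (\1_B w - p) + p * f w).
    by apply/funext => w; ring.
  rewrite meanD; [|by bounded|by bounded].
  by rewrite h meanZ// f0 mulr0 addr0.
move=> sA; suff : H A by case.
apply: (smallest_sub dH cH).
have -> : smallest (@dynkin T) (cylinder k) = <<s cylinder k >>.
  exact: (setI_closed_g_dynkin_g_sigma_algebra (@cylinder_setI k)).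
exact: sigma_gen_past.
Qed.

End Independence.

(** Independent centred variables are martingale differences for their natural filtration. The value
    at index 0 is set to 0 to be measurable for the sigma-algebra of the empty past. *)
Lemma independent_moment_bound (X : nat -> T -> R) (C : R) : 0 < C ->
  (forall k, measurable_fun setT (X k)) -> mutually_independent P X ->
  (forall k, (0 < k)%N -> mean P (fun w => clip C (X k w)) = 0) ->
  moment_bound P (fun k w => if k == 0%N then 0 else clip C (X k w)) 1.
Proof.
move=> C0 mX indX mean0.
apply: (@martingale_moment_bound _ _ _ P (fun k => sigma_gen X (past k)) _ C) => //.
- split=> [k|m n mn]; first exact: sigma_gen_sub.
  by apply: sigma_genS => i /andP[i0 im]; rewrite /past /= i0 (leq_trans im).
- move=> [|k] /=; first by apply: bounded_wrt_cst; exact: (sigma_gen_sub mX _).1.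
  apply: bounded_wrt_clip; first exact: ltW.
  move=> B mB; apply: sub_sigma_algebra; exists k.+1; first by rewrite /past /= leqnn.
  by exists B => //; rewrite setTI.
- by move=> [|k] w /=; [rewrite normr0 ltW|apply: norm_clip_le; exact: ltW].
- move=> k A FA; apply: (independent_integral_past mX indX (ltW C0) _ FA).
  exact: mean0.
Qed.

(** [Y] clips the increments of the martingale, not [X]: the increments are adapted to the
    filtration, whereas [X] equals them only almost surely. *)
Lemma martingale_difference_moment_bound (X : nat -> T -> R) (C : R) : 0 < C ->
  (forall k, (0 < k)%N -> {ae P, forall w, `|X k w| <= C}) ->
  martingale_difference P X ->
  exists Y : nat -> T -> R,
    [/\ forall k, bounded_wrt measurable (Y k), forall k w, `|Y k w| <= C,
        forall k, (0 < k)%N -> {ae P, forall w, Y k w = X k w}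
      & moment_bound P Y 1].
Proof.
move=> C0 XC [F [M [[filF mM intM ceM] XM]]].
have [sF F_nd] := filF.
pose D k w := M k.+1 w - M k w.
pose Y k w := if k is k'.+1 then clip C (D k' w) else 0.
have mMk j k : (j <= k)%N -> measurable_wrt (F k) (M j).
  by move=> jk B mB; apply: (F_nd _ _ jk); exact: mM.
have mD k : measurable_wrt (F k.+1) (D k).
  apply/(measurable_wrtP _ (sF _).1).
  by apply: measurable_funB; apply/(measurable_wrtP _ (sF _).1); exact: mMk.
have bY k : bounded_wrt (F k) (Y k).
  case: k => [|k]; first by apply: bounded_wrt_cst; exact: (sF _).1.
  by apply: bounded_wrt_clip => //; exact: ltW.
have bYm k : bounded_wrt measurable (Y k) := bounded_wrtS (sF k).2 (bY k).
have YC k w : `|Y k w| <= C.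
  by case: k => [|k]; [rewrite normr0 ltW|exact: norm_clip_le (ltW C0)].
have YD k : {ae P, forall w, Y k.+1 w = D k w}.
  have := XC k.+1 isT; have := XM k.+1 isT.
  by apply: filterS2 => w /= XMw XCw; rewrite /Y clip_id// /D -XMw.
exists Y; split => //.
  move=> [//|k] _; have := YD k; have := XM k.+1 isT.
  by apply: filterS2 => w /= -> ->.
apply: (martingale_moment_bound filF bY C0 YC) => k A FA.
have mA : measurable A by exact: (sF k).2.
rewrite (Rintegral_ae_eq mA _ _ (YD k)); last 2 first.
- by apply/measurable_wrt_measurable; exact: (bYm k.+1).1.
- apply/measurable_wrt_measurable => B mB; apply: (sF k.+1).2; exact: mD.
have [_ _ _ /(_ A FA) ce] := ceM k.
rewrite RintegralB//; [|exact: integrableS (intM _)|exact: integrableS (intM _)].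
by rewrite /Rintegral ce subrr.
Qed.

End Reduction.

(** * Dyadic blocks *)

Lemma odd_leq_mul (a b i : nat) :
  (2 * (a + i + b) + 1 <= (2 * (a + b) + 1) * (2 * i + 1))%N.
Proof. nia. Qed.

Section RealAnalysis.
Variable R : realType.
Implicit Types x y s t sigma : R.

Lemma lipschitz_of_derive1 (f df : R -> R) : (forall x, is_derive x 1 f (df x)) ->
  (forall x, `|df x| <= 1) -> forall x y, `|f x - f y| <= `|x - y|.
Proof.
move=> fdf df1 x y; wlog xy : x y / x <= y.
  move=> H; have [/H//|/ltW/H] := leP x y.
  by rewrite distrC (distrC y).
have cf : {within `[x, y], continuous f}.
  apply: continuous_subspaceT => z; apply: differentiable_continuous.
  by apply/derivable1_diffP; exact: (@ex_derive _ _ _ _ _ _ _ (fdf z)).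
have [c _ fE] := MVT_segment xy (fun z _ => fdf z) cf.
by rewrite distrC fE normrM (distrC x) ler_piMl.
Qed.

Lemma cos_lipschitz x y : `|cos x - cos y| <= `|x - y|.
Proof.
apply: lipschitz_of_derive1 (@is_derive_cos R) _ x y => z.
by rewrite normrN sin_max.
Qed.

Lemma sin_lipschitz x y : `|sin x - sin y| <= `|x - y|.
Proof. by apply: lipschitz_of_derive1 (@is_derive_sin R) _ x y; exact: cos_max. Qed.

Lemma ln2_ge_half : 1 / 2 <= ln 2 :> R.
Proof.
rewrite -ler_expR lnK ?posrE//.
have h := expR_ge1Dx (- (1 / 2) : R).
have h2 : expR (1 / 2) * expR (- (1 / 2)) = 1 :> R := expRxMexpNx_1 _.
have e0 := expR_gt0 (1 / 2 : R); nra.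
Qed.

Lemma ln2_le1 : ln 2 <= 1 :> R.
Proof. by apply: (@le_ln1Dx R 1); rewrite (lt_trans _ ltr01)// ltrN10. Qed.

Lemma expR_ln2M (j : nat) : expR (ln 2 * j%:R) = 2 ^+ j :> R.
Proof. by rewrite expRM_natr lnK ?posrE. Qed.

Lemma ln_exp2 (j : nat) : ln (2 ^ j)%:R = ln 2 * j%:R :> R.
Proof. by rewrite natrX lnXn// mulr_natr. Qed.

Lemma geometric_sum_le (q : R) n : 0 <= q < 1 -> \sum_(i < n) q ^+ i <= (1 - q)^-1.
Proof.
move=> /andP[q0 q1]; have q1' : 0 < 1 - q by rewrite subr_gt0.
rewrite -[leRHS]mul1r ler_pdivlMr//.
suff -> : (\sum_(i < n) q ^+ i) * (1 - q) = 1 - q ^+ n.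
  by rewrite gerBl exprn_ge0.
elim: n => [|n IHn]; first by rewrite big_ord0 mul0r expr0 subrr.
by rewrite big_ord_recr/= mulrDl IHn exprSr; ring.
Qed.

(** Write q = p^4. Then (i + 1) p^i is at most the geometric sum 1/(1 - p), so p^(2i) absorbs the
    square and r = p^2 remains. *)
Lemma sqr_geometric_le (q : R) : 0 < q < 1 -> exists2 K : R, 0 <= K &
  exists2 r : R, 0 <= r < 1 &
    forall i : nat, (2 * i%:R + 1) ^+ 2 * q ^+ i <= K * r ^+ i.
Proof.
move=> /andP[q0 q1].
have sq1 (z : R) : 0 < z < 1 -> 0 < Num.sqrt z < 1.
  move=> /andP[z0 z1]; rewrite sqrtr_gt0 z0 -[X in _ < X]sqrtr1.
  by rewrite ltr_sqrt.
pose p := Num.sqrt (Num.sqrt q).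
have /andP[p0 p1] : 0 < p < 1 by apply: (sq1); apply: sq1; rewrite q0.
have qE : q = p ^+ 2 ^+ 2 by rewrite sqr_sqrtr ?sqrtr_ge0// sqr_sqrtr// ltW.
have p1' : 0 < 1 - p by rewrite subr_gt0.
exists (4 * (1 - p)^-1 ^+ 2).
  by rewrite mulr_ge0// exprn_ge0// invr_ge0 ltW.
exists (p ^+ 2); first by rewrite sqr_ge0/= expr2; nra.
move=> i.
have h : (i%:R + 1) * p ^+ i <= (1 - p)^-1.
  apply: le_trans (@geometric_sum_le p i.+1 _); last by rewrite (ltW p0).
  rewrite natr1 mulr_natl -[i.+1 in leLHS]card_ord -sumr_const.
  apply: ler_sum => k _; rewrite ler_wiXn2l ?(ltW p0) ?(ltW p1)//.
  by rewrite -ltnS.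
have qi : q ^+ i = (p ^+ i) ^+ 2 * (p ^+ 2) ^+ i.
  by rewrite qE -!exprM -exprD; congr (_ ^+ _); lia.
have r0 : 0 <= (p ^+ 2) ^+ i by rewrite exprn_ge0// sqr_ge0.
rewrite qi mulrA; apply: ler_wpM2r => //.
have u0 : 0 <= p ^+ i by rewrite exprn_ge0// ltW.
have i0 : 0 <= i%:R :> R by [].
have h2 : ((i%:R + 1) * p ^+ i) ^+ 2 <= (1 - p)^-1 ^+ 2.
  by rewrite lerXn2r ?nnegrE ?mulr_ge0 ?addr_ge0// invr_ge0 ltW.
have h3 : (2 * i%:R + 1) ^+ 2 <= 4 * (i%:R + 1) ^+ 2 :> R by nra.
have := ler_wpM2r (sqr_ge0 (p ^+ i)) h3; move: h2; rewrite exprMn; lra.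
Qed.

(** Detaches the offset [i] from the logarithmic factor at polynomial cost, harmless against
    geometric decay. *)
Lemma sqrt_odd_pow_le (a b i th : nat) : (th <= 4)%N ->
  Num.sqrt ((2 * (a + i + b) + 1) ^ th)%:R <=
    Num.sqrt ((2 * (a + b) + 1) ^ th)%:R * (2 * i%:R + 1) ^+ 2 :> R.
Proof.
move=> th4.
have -> : (2 * i%:R + 1) ^+ 2 = Num.sqrt (((2 * i + 1) ^ 4)%:R) :> R.
  rewrite natrX (_ : 4 = 2 * 2)%N// exprM sqrtr_sqr ger0_norm ?sqr_ge0//.
  by rewrite natrD natrM.
rewrite -sqrtrM// -natrM ler_wsqrtr// ler_nat.
apply: (@leq_trans (((2 * (a + b) + 1) * (2 * i + 1)) ^ th)).
  by case: (th) => // ?; rewrite leq_exp2r// odd_leq_mul.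
rewrite expnMn leq_mul2l; apply/orP; right.
by rewrite leq_pexp2l// addn1.
Qed.

(** Summation by parts; the partial sums [U] start at [a], so the only boundary term is at [b]. *)
Lemma abel_summation_le (u v : nat -> R) (B : R) a b : (a <= b)%N -> 0 <= B ->
  (forall c, (a <= c <= b)%N -> `|\sum_(a <= k < c) u k| <= B) ->
  `|\sum_(a <= k < b) v k * u k| <=
    B * (`|v b| + \sum_(a <= k < b) `|v k - v k.+1|).
Proof.
move=> ab B0 uB; pose U c := \sum_(a <= k < c) u k.
have E : \sum_(a <= k < b) v k * u k =
    v b * U b + \sum_(a <= k < b) (v k - v k.+1) * U k.+1.
  elim: b ab {uB} => [|b IHb].
    by rewrite leqn0 => /eqP ->; rewrite /U !big_geq// mulr0 addr0.
  rewrite leq_eqVlt => /predU1P[<-|]; first by rewrite /U !big_geq// mulr0 addr0.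
  rewrite ltnS => ab; rewrite !big_nat_recr//= IHb//.
  by rewrite /U big_nat_recr//=; ring.
rewrite E mulrDr; apply: (le_trans (ler_normD _ _)); apply: lerD.
  by rewrite normrM mulrC ler_wpM2r// uB// ab/=.
apply: (le_trans (ler_norm_sum _ _ _)); rewrite mulr_sumr.
rewrite !big_nat; apply: ler_sum => k /andP[ak kb].
by rewrite normrM mulrC ler_wpM2r// uB// kb (leq_trans ak).
Qed.

Definition pw sigma (k : nat) : R := expR (- (sigma * ln k%:R)).

Lemma pw_gt0 sigma k : 0 < pw sigma k. Proof. exact: expR_gt0. Qed.

Lemma ler_ln_nat (a b : nat) : (0 < a)%N -> (a <= b)%N -> ln a%:R <= ln b%:R :> R.
Proof.
by move=> a0 ab; rewrite ler_ln ?posrE ?ltr0n ?ler_nat// (leq_trans a0).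
Qed.

Lemma ler_pw sigma a b : 0 <= sigma -> (0 < a)%N -> (a <= b)%N ->
  pw sigma b <= pw sigma a.
Proof.
by move=> s0 a0 ab; rewrite ler_expR lerN2 ler_wpM2l// ler_ln_nat.
Qed.

(** [phi] will be [cos] or [sin]. The final value, the telescoping variation of k^(-sigma), and that
    of phi (s ln k), at most ln 2 <= 1 over the block, each contribute one [pw sigma (2 ^ j)]. *)
Lemma weight_variation_le (phi : R -> R) (v : nat -> R) sigma s j b :
  (forall k, v k = pw sigma k * phi (s * ln k%:R)) ->
  (forall x, `|phi x| <= 1) -> (forall x y, `|phi x - phi y| <= `|x - y|) ->
  0 <= sigma -> 0 <= s <= 1 -> (2 ^ j <= b <= 2 ^ j.+1)%N ->
  `|v b| + \sum_(2 ^ j <= k < b) `|v k - v k.+1| <= 3 * pw sigma (2 ^ j).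
Proof.
move=> vE phi1 phiL s0 /andP[sg0 sg1] /andP[jb bj].
have j0 : (0 < 2 ^ j)%N by rewrite expn_gt0.
have pw0 := pw_gt0 sigma.
have vb : `|v b| <= pw sigma (2 ^ j).
  rewrite vE normrM gtr0_norm// -[leRHS]mulr1; apply: ler_pM => //; first exact: ltW.
  exact: ler_pw.
pose p := pw sigma (2 ^ j).
have h : \sum_(2 ^ j <= k < b) `|v k - v k.+1| <=
    \sum_(2 ^ j <= k < b) ((- pw sigma k.+1 - - pw sigma k) +
                           p * (ln k.+1%:R - ln k%:R)).
  rewrite !big_nat; apply: ler_sum => k /andP[jk kb].
  have k0 : (0 < k)%N by exact: leq_trans jk.
  have lk : ln k%:R <= ln k.+1%:R :> R by exact: ler_ln_nat.
  have -> : v k - v k.+1 = (pw sigma k - pw sigma k.+1) * phi (s * ln k.+1%:R) +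
      pw sigma k * (phi (s * ln k%:R) - phi (s * ln k.+1%:R)) by rewrite !vE; ring.
  apply: (le_trans (ler_normD _ _)); apply: lerD; rewrite normrM.
    have pk : 0 <= pw sigma k - pw sigma k.+1 by rewrite subr_ge0 ler_pw.
    have -> : - pw sigma k.+1 - - pw sigma k = pw sigma k - pw sigma k.+1 by ring.
    by rewrite (ger0_norm pk) ler_piMr.
  rewrite gtr0_norm//; apply: ler_pM => //; first exact: ltW.
    by apply: ler_pw.
  apply: (le_trans (phiL _ _)); rewrite -mulrBr normrM (ger0_norm sg0).
  by rewrite distrC ger0_norm ?subr_ge0// ler_piMl// subr_ge0.
have p0 : 0 < p by exact: pw0.
have lnb : ln b%:R - ln (2 ^ j)%:R <= 1 :> R.
  have : ln b%:R <= ln (2 ^ j.+1)%:R :> R.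
    by apply: ler_ln_nat => //; exact: leq_trans jb.
  by rewrite !ln_exp2 -[j.+1%:R]natr1 mulrDr mulr1; have := ln2_le1; lra.
rewrite big_split/= -mulr_sumr in h.
rewrite (telescope_sumr (fun k => - pw sigma k) jb) in h.
rewrite (telescope_sumr (fun k => ln k%:R) jb) in h.
have := ler_wpM2l (ltW p0) lnb; have := pw0 b; rewrite -/p in vb h *.
by lra.
Qed.

End RealAnalysis.

(** * Trigonometric sums over dyadic blocks *)

Section Blocks.
Variables (R : realType) (x : nat -> R).

Definition cosum (t : R) a b : R := \sum_(a <= k < b) x k * cos (t * ln k%:R).
Definition sisum (t : R) a b : R := \sum_(a <= k < b) x k * sin (t * ln k%:R).

(** One integer [l] dominates both the binary logarithm of [n] and [j]; [2 * l + 1], the odd order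
    of the moments used, stands for log n + j. *)
Definition dyadic_growth (G : R) (th : nat) : Prop :=
  forall l n j b, (n < 2 ^ l)%N -> (j < l)%N -> (2 ^ j <= b <= 2 ^ j.+1)%N ->
    `|cosum n%:R (2 ^ j) b| <= G * Num.sqrt (((2 * l + 1) ^ th * 2 ^ j)%:R) /\
    `|sisum n%:R (2 ^ j) b| <= G * Num.sqrt (((2 * l + 1) ^ th * 2 ^ j)%:R).

(** The addition formulas separate [n] from [s]; the factors in [s] join the weight of the Abel
    summation, so the bound is uniform in [s]. Two terms of constant 3 make 6. *)
Lemma block_le (B sigma s : R) n j b : 0 <= B -> 0 <= sigma -> 0 <= s <= 1 ->
  (2 ^ j <= b <= 2 ^ j.+1)%N ->
  (forall c, (2 ^ j <= c <= b)%N ->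
     `|cosum n%:R (2 ^ j) c| <= B /\ `|sisum n%:R (2 ^ j) c| <= B) ->
  `|\sum_(2 ^ j <= k < b) x k * pw sigma k * cos ((n%:R + s) * ln k%:R)|
     <= 6 * pw sigma (2 ^ j) * B /\
  `|\sum_(2 ^ j <= k < b) x k * pw sigma k * sin ((n%:R + s) * ln k%:R)|
     <= 6 * pw sigma (2 ^ j) * B.
Proof.
move=> B0 sg0 s01 jb nB; have /andP[jb1 jb2] := jb.
have A (f phi : R -> R) : (forall z, `|phi z| <= 1) ->
    (forall z y, `|phi z - phi y| <= `|z - y|) ->
    (forall c, (2 ^ j <= c <= b)%N ->
       `|\sum_(2 ^ j <= k < c) x k * f (n%:R * ln k%:R)| <= B) ->
    `|\sum_(2 ^ j <= k < b) (pw sigma k * phi (s * ln k%:R)) *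
        (x k * f (n%:R * ln k%:R))| <= 3 * pw sigma (2 ^ j) * B.
  move=> phi1 phiL fB; apply: (le_trans (@abel_summation_le R _
    (fun k => pw sigma k * phi (s * ln k%:R)) B _ _ jb1 B0 fB)).
  rewrite mulrC ler_wpM2r//.
  exact: (weight_variation_le (fun=> erefl)).
have cB c (h : (2 ^ j <= c <= b)%N) := (nB c h).1.
have sB c (h : (2 ^ j <= c <= b)%N) := (nB c h).2.
have cc := A cos cos (@cos_max R) (@cos_lipschitz R) cB.
have cs := A cos sin (@sin_max R) (@sin_lipschitz R) cB.
have sc := A sin cos (@cos_max R) (@cos_lipschitz R) sB.
have ss := A sin sin (@sin_max R) (@sin_lipschitz R) sB.
split.
- rewrite (_ : \sum_(_ <= _ < _) _ =
    \sum_(2 ^ j <= k < b) (pw sigma k * cos (s * ln k%:R)) *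
        (x k * cos (n%:R * ln k%:R)) -
    \sum_(2 ^ j <= k < b) (pw sigma k * sin (s * ln k%:R)) *
        (x k * sin (n%:R * ln k%:R))); last first.
    by rewrite -sumrB; apply: eq_bigr => k _; rewrite mulrDl cosD; ring.
  by apply: (le_trans (ler_normB _ _)); lra.
- rewrite (_ : \sum_(_ <= _ < _) _ =
    \sum_(2 ^ j <= k < b) (pw sigma k * cos (s * ln k%:R)) *
        (x k * sin (n%:R * ln k%:R)) +
    \sum_(2 ^ j <= k < b) (pw sigma k * sin (s * ln k%:R)) *
        (x k * cos (n%:R * ln k%:R))); last first.
    by rewrite -big_split/=; apply: eq_bigr => k _; rewrite mulrDl sinD; ring.
  by apply: (le_trans (ler_normD _ _)); lra.
Qed.

Lemma dyadic_sum_le (f E : nat -> R) J :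
  (forall j, 0 <= E j) ->
  (forall j b, (J <= j)%N -> (2 ^ j <= b <= 2 ^ j.+1)%N ->
     `|\sum_(2 ^ j <= k < b) f k| <= E j) ->
  forall N b, (2 ^ J <= b <= 2 ^ (J + N))%N ->
    `|\sum_(2 ^ J <= k < b) f k| <= \sum_(i < N) E (J + i)%N.
Proof.
move=> E0 fE; elim=> [|N IHN] b /andP[Jb bN].
  rewrite addn0 in bN; rewrite big_geq//.
  by rewrite normr0 big_ord0.
rewrite big_ord_recr/=; have [bN'|/ltnW bN'] := leqP b (2 ^ (J + N)).
  by rewrite -[leLHS]addr0 lerD// IHN// Jb.
have JN : (2 ^ J <= 2 ^ (J + N))%N by rewrite leq_exp2l// leq_addr.
rewrite (big_cat_nat JN bN')/=; apply: (le_trans (ler_normD _ _)); apply: lerD.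
  by apply: IHN; rewrite JN leqnn.
by apply: fE; rewrite ?leq_addr// bN' -addnS.
Qed.

(** Block J + i decays like q^i with q = 2^(-(sigma1 - 1/2)), up to the factor (2i + 1)^2. As q
    depends on [sigma1] alone, [K] serves all larger [sigma]. *)
Lemma tail_le (G sigma1 : R) th : 0 <= G -> 1 / 2 < sigma1 -> (th <= 4)%N ->
  dyadic_growth G th ->
  exists2 K : R, 0 <= K & forall (sigma s : R) n lam J b, sigma1 <= sigma ->
    0 <= s <= 1 -> (0 < lam)%N -> (n < 2 ^ lam)%N -> (2 ^ J <= b)%N ->
    let M := K * expR (- ((sigma - 1 / 2) * (ln 2 * J%:R))) *
             Num.sqrt ((2 * (J + lam) + 1) ^ th)%:R in
    `|\sum_(2 ^ J <= k < b) x k * pw sigma k * cos ((n%:R + s) * ln k%:R)| <= M /\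
    `|\sum_(2 ^ J <= k < b) x k * pw sigma k * sin ((n%:R + s) * ln k%:R)| <= M.
Proof.
move=> G0 sg1 th4 gr.
pose q : R := expR (- ((sigma1 - 1 / 2) * ln 2)).
have ln20 : 0 < ln 2 :> R by have := @ln2_ge_half R; lra.
have q01 : 0 < q < 1.
  by rewrite expR_gt0 expR_lt1 oppr_lt0 mulr_gt0// subr_gt0.
have [K1 K10 [r r01 Kr]] := sqr_geometric_le q01.
pose K2 := K1 * (1 - r)^-1.
have K20 : 0 <= K2.
  by rewrite mulr_ge0// invr_ge0 subr_ge0; case/andP: r01 => _ /ltW.
exists (6 * G * K2); first by rewrite mulr_ge0// mulr_ge0.
move=> sigma s n lam J b sg s01 lam0 nlam Jb M.
have sg0 : 0 <= sigma by lra.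
pose E j := 6 * pw sigma (2 ^ j) *
  (G * Num.sqrt (((2 * (j + lam) + 1) ^ th * 2 ^ j)%:R)).
have E0 j : 0 <= E j.
  by rewrite !mulr_ge0 ?sqrtr_ge0// ltW// pw_gt0.
have nB j : let B := G * Num.sqrt (((2 * (j + lam) + 1) ^ th * 2 ^ j)%:R) in
    forall c, (2 ^ j <= c <= 2 ^ j.+1)%N ->
     `|cosum n%:R (2 ^ j) c| <= B /\ `|sisum n%:R (2 ^ j) c| <= B.
  (* The growth hypothesis is used with l = j + lam, which exceeds [j] since [lam] is positive. *)
  move=> B c jc; apply: gr => //.
    by apply: (leq_trans nlam); rewrite leq_exp2l// leq_addl.
  by rewrite -[X in (X < _)%N]addn0 ltn_add2l.
have blk j c : (2 ^ j <= c <= 2 ^ j.+1)%N ->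
    `|\sum_(2 ^ j <= k < c) x k * pw sigma k * cos ((n%:R + s) * ln k%:R)| <= E j /\
    `|\sum_(2 ^ j <= k < c) x k * pw sigma k * sin ((n%:R + s) * ln k%:R)| <= E j.
  move=> jc; apply: block_le => //; first by rewrite mulr_ge0// sqrtr_ge0.
  move=> c' /andP[jc' c'c]; apply: nB; rewrite jc' /=.
  by case/andP: jc => _; exact: leq_trans.
(* A crude count of [b] blocks: the geometric bound does not depend on their number. *)
have bN : (2 ^ J <= b <= 2 ^ (J + b))%N.
  by rewrite Jb/= (leq_trans (ltnW (ltn_expl b (leqnn 2))))// leq_exp2l// leq_addl.
suff HE : \sum_(i < b) E (J + i)%N <= M.
  split; apply: le_trans HE.
  - by apply: dyadic_sum_le bN => // j c _ /blk[].
  - by apply: dyadic_sum_le bN => // j c _ /blk[].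
pose A := 6 * G * expR (- ((sigma - 1 / 2) * (ln 2 * J%:R))) *
  Num.sqrt ((2 * (J + lam) + 1) ^ th)%:R.
have A0 : 0 <= A by rewrite !mulr_ge0 ?sqrtr_ge0 ?expR_ge0.
have EA i : E (J + i)%N <= A * ((2 * i%:R + 1) ^+ 2 * q ^+ i).
  have sE : Num.sqrt (((2 * (J + i + lam) + 1) ^ th * 2 ^ (J + i))%:R : R) <=
      Num.sqrt ((2 * (J + lam) + 1) ^ th)%:R * (2 * i%:R + 1) ^+ 2 *
      expR (1 / 2 * (ln 2 * (J + i)%:R)).
    rewrite natrM sqrtrM//; apply: ler_pM; rewrite ?sqrtr_ge0//.
      exact: sqrt_odd_pow_le.
    rewrite natrX -expR_ln2M.
    have -> : expR (ln 2 * (J + i)%:R) = expR (1 / 2 * (ln 2 * (J + i)%:R)) ^+ 2 :> R.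
      by rewrite -expRM_natl; congr expR; field.
    by rewrite sqrtr_sqr ger0_norm// expR_ge0.
  apply: (@le_trans _ _ (6 * pw sigma (2 ^ (J + i)) * (G *
     (Num.sqrt ((2 * (J + lam) + 1) ^ th)%:R * (2 * i%:R + 1) ^+ 2 *
      expR (1 / 2 * (ln 2 * (J + i)%:R)))))).
    apply: ler_wpM2l; first by rewrite mulr_ge0// ltW// pw_gt0.
    exact: ler_wpM2l.
  have hq : pw sigma (2 ^ (J + i)) * expR (1 / 2 * (ln 2 * (J + i)%:R)) <=
      expR (- ((sigma - 1 / 2) * (ln 2 * J%:R))) * q ^+ i.
    rewrite /pw /q ln_exp2 -expRM_natl -!expRD ler_expR natrD.
    have : 0 <= (sigma - sigma1) * (ln 2 * i%:R).
      by rewrite mulr_ge0 ?subr_ge0// mulr_ge0// ltW.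
    by lra.
  set D := Num.sqrt _; set I2 := (_ + 1) ^+ 2.
  have D0 : 0 <= D by exact: sqrtr_ge0.
  have I20 : 0 <= I2 by exact: sqr_ge0.
  have := ler_wpM2l (mulr_ge0 (mulr_ge0 (mulr_ge0 (ler0n _ 6) G0) D0) I20) hq.
  rewrite /A -/D; congr (_ <= _); ring.
apply: (@le_trans _ _ (\sum_(i < b) A * ((2 * i%:R + 1) ^+ 2 * q ^+ i))).
  by apply: ler_sum => i _; exact: EA.
rewrite -mulr_sumr /M (_ : 6 * G * K2 * _ * _ = A * K2); last by rewrite /A; ring.
rewrite ler_wpM2l//.
apply: (@le_trans _ _ (\sum_(i < b) K1 * r ^+ i)).
  by apply: ler_sum => i _; exact: Kr.
by rewrite -mulr_sumr ler_wpM2l// geometric_sum_le.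
Qed.

End Blocks.

(** * Almost sure growth of the block sums *)

Section AlmostSureGrowth.
Context (d : measure_display) (T : measurableType d) (R : realType).
Variable P : probability T R.
Variables (Y : nat -> T -> R) (th : nat).
Hypothesis bY : forall k, bounded_wrt measurable (Y k).
Hypothesis mY : moment_bound P Y th.

Let big_mask (f : nat -> R) (a b : nat) :
  \sum_(k < b) (if (a <= k)%N then f k else 0) = \sum_(a <= k < b) f k.
Proof.
rewrite -big_mkcond/= -(big_mkord (fun k => (a <= k)%N) f).
have [ab|/ltnW ba] := leqP a b; last first.
  rewrite [RHS]big_geq// big_nat_cond big1// => k /andP[/andP[_ kb]].
  by rewrite leqNgt (leq_trans kb ba).
rewrite (big_cat_nat (leq0n a) ab)/= big_nat_cond big1 ?add0r; last first.
  by move=> k /andP[/andP[_ ka]]; rewrite leqNgt ka.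
rewrite big_nat_cond [RHS]big_nat_cond; apply: eq_bigl => k.
by case: (a <= k)%N; rewrite ?andbF ?andbT.
Qed.

(** The coefficients f (n ln k), masked to the block, are at most 1 in absolute value on at most 2^j
    indices, so V = 2^j. *)
Lemma block_moment_le : exists2 K : R, 0 < K &
  forall (f : R -> R) (n j b m : nat), (forall z, `|f z| <= 1) ->
    (b <= 2 ^ j.+1)%N -> odd m ->
    mean P (fun w =>
      (\sum_(2 ^ j <= k < b) Y k w * f (n%:R * ln k%:R)) ^+ (2 * m)) <=
      (K * (m ^ th * 2 ^ j)%:R) ^+ m.
Proof.
have [K K0 HK] := mY; exists K => // f n j b m f1 bj om.
pose a k := if (2 ^ j <= k)%N then f (n%:R * ln k%:R) else 0 : R.
have V0 : 0 < (2 ^ j)%:R :> R by rewrite ltr0n expn_gt0.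
have a0 : a 0%N = 0 by rewrite /a leqn0 expn_eq0.
have aV : \sum_(k < b) a k ^+ 2 <= (2 ^ j)%:R.
  apply: (@le_trans _ _ (\sum_(k < b) (if (2 ^ j <= k)%N then 1 else 0))).
    apply: ler_sum => k _; rewrite /a; case: ifP => _; last by rewrite expr0n.
    by rewrite -real_normK ?num_real// exprn_ile1.
  rewrite (big_mask (fun=> 1)) sumr_const_nat ler_nat.
  by rewrite leq_subLR addnn -mul2n -expnS.
have := HK b a _ m a0 V0 aV om.
rewrite -mulrA -natrX -natrM; congr (mean _ _ <= _).
apply/funext => w; congr (_ ^+ _).
rewrite -big_mask; apply: eq_bigr => k _; rewrite /a.
by case: ifP => _; rewrite ?mul0r// mulrC.
Qed.

Lemma ae_dyadic_growth :
  {ae P, forall w, exists2 G : R, 0 <= G & dyadic_growth (Y ^~ w) G th}.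
Proof.
have [K K0 HK] := block_moment_le.
(* With the extra 4 each normalised pair of moments of order 2(2l + 1) has mean at most 16^(-l)/2,
   which beats the at most 2 * 8^l triples (n, j, b) and leaves 2^(-l). *)
pose D l j : R := (4 * K * ((2 * l + 1) ^ th * 2 ^ j)%:R).
have D0 l j : 0 < D l j.
  by rewrite mulr_gt0 ?mulr_gt0// ltr0n muln_gt0 !expn_gt0 addn1.
pose S (f : R -> R) n j b w := \sum_(2 ^ j <= k < b) Y k w * f (n%:R * ln k%:R).
pose Q l w := \sum_(n < 2 ^ l) \sum_(j < l) \sum_(b < (2 ^ l).+1 | (b <= 2 ^ j.+1)%N)
  (D l j ^- (2 * l + 1) * (S cos n j b w ^+ (2 * (2 * l + 1)) +
                           S sin n j b w ^+ (2 * (2 * l + 1)))).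
have bS f n j b : bounded_wrt measurable (S f n j b).
  rewrite /S; under eq_fun do under eq_bigr do rewrite mulrC.
  by bounded; exact: bY.
have bQ l : bounded_wrt measurable (Q l).
  by rewrite /Q; bounded; exact: bS.
have Q0 l w : 0 <= Q l w.
  apply: sumr_ge0 => n _; apply: sumr_ge0 => j _; apply: sumr_ge0 => b _.
  rewrite mulr_ge0 ?addr_ge0 ?exprn_even_ge0//.
  by rewrite invr_ge0 exprn_ge0// ltW.
have EQ l : mean P (Q l) <= 2^-1 ^+ l.
  rewrite /Q mean_sum => [|n _]; last by bounded; exact: bS.
  apply: (@le_trans _ _ (\sum_(n < 2 ^ l) \sum_(j < l)
      \sum_(b < (2 ^ l).+1) 2 * 4 ^- (2 * l + 1))).
    apply: ler_sum => n _.
    rewrite mean_sum => [|j _]; last by bounded; exact: bS.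
    apply: ler_sum => j _.
    rewrite mean_sum => [|b _]; last by bounded; exact: bS.
    rewrite big_mkcond/=; apply: ler_sum => b _.
    case: ifP => bj; last by rewrite mulr_ge0// invr_ge0 exprn_ge0.
    rewrite meanZ; last by bounded; exact: bS.
    rewrite meanD; [|by bounded; exact: bS|by bounded; exact: bS].
    have om : odd (2 * l + 1) by rewrite addn1 /= mul2n odd_double.
    have h1 := HK _ n j b _ (@cos_max R) bj om.
    have h2 := HK _ n j b _ (@sin_max R) bj om.
    rewrite mulrC ler_pdivrMr ?exprn_gt0//.
    have -> : 2 * 4 ^- (2 * l + 1) * D l j ^+ (2 * l + 1) =
        2 * (K * ((2 * l + 1) ^ th * 2 ^ j)%:R) ^+ (2 * l + 1).
      rewrite /D -mulrA -exprVn -exprMn; congr (_ * _ ^+ _).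
      by rewrite !mulrA mulVf// mul1r.
    by rewrite mulr2n mulrDl mul1r; exact: lerD.
  rewrite !sumr_const !card_ord -!mulrnA -[_ *+ _]mulr_natr.
  have cnt : ((2 ^ l).+1 * (l * 2 ^ l) <= 2 * 8 ^ l)%N.
    have -> : (8 ^ l = 2 ^ l * 2 ^ l * 2 ^ l)%N by rewrite -!expnMn.
    have ll : (l <= 2 ^ l)%N by exact: ltnW (ltn_expl _ _).
    have l0 : (0 < 2 ^ l)%N by rewrite expn_gt0.
    by nia.
  have -> : 2 * 4 ^- (2 * l + 1) = 2^-1 * 16 ^- l :> R.
    rewrite exprD exprM expr1 (_ : 4 ^+ 2 = 16); last by ring.
    by field; rewrite expf_neq0.
  apply: (@le_trans _ _ (2^-1 * 16 ^- l * (2 * 8 ^ l)%:R)).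
    by rewrite ler_wpM2l ?ler_nat// divr_ge0 ?invr_ge0// exprn_ge0.
  have -> : 16 ^+ l = 2 ^+ l * 8 ^+ l :> R by rewrite -exprMn -natrM.
  rewrite exprVn natrM natrX le_eqVlt; apply/orP; left; apply/eqP.
  by field; rewrite !expf_neq0.
pose g l := EFin \o Q l.
have g0 l w : setT w -> (0 <= g l w)%E by rewrite lee_fin.
have mg l : measurable_fun setT (g l).
  by apply/measurable_EFinP/measurable_wrt_measurable; exact: (bQ l).1.
(* Summable means make the sum of all [Q l] integrable, hence almost surely finite; its value then
   bounds every [Q l] at once. *)
have intF : P.-integrable setT (fun w => \sum_(l <oo) g l w)%E.
  apply/integrableP; split.
    by apply: ge0_emeasurable_sum => // l w _ _; exact: g0.
  rewrite (eq_integral (fun w => \sum_(l <oo) g l w)%E); last first.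
    move=> w _; rewrite gee0_abs//; apply: nneseries_ge0 => l _ _; exact: g0.
  rewrite integral_nneseries//.
  apply: (@le_lt_trans _ _ (\sum_(l <oo) (2^-1 ^+ l)%:E)%E).
    apply: lee_nneseries => [l _ _|l _]; first by apply: integral_ge0 => w; exact: g0.
    by rewrite -EFin_mean// lee_fin.
  apply: (@le_lt_trans _ _ 2%:E); last exact: ltry.
  apply: lime_le.
    by apply: is_cvg_nneseries => l _ _; rewrite lee_fin exprn_ge0.
  apply: nearW => N; rewrite sumEFin lee_fin big_mkord.
  have h2 : (1 - 2^-1)^-1 = 2 :> R by rewrite -[RHS]invrK; congr (_^-1); lra.
  by rewrite -[leRHS]h2; apply: geometric_sum_le; apply/andP; split; lra.
have := integrable_ae measurableT intF.
apply: filterS => w /(_ I) fin.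
pose G0 := fine (\sum_(l <oo) g l w)%E; pose M := Num.max 1 G0.
have QG l : Q l w <= G0.
  rewrite -lee_fin fineK//.
  apply: (@le_trans _ _ (\sum_(0 <= i < l.+1) g i w)%E).
    rewrite big_nat_recr//= leeDr//.
    by apply: sume_ge0 => i _; exact: g0.
  by apply: nneseries_lim_ge => i _ _; exact: g0.
have M1 : 1 <= M by rewrite le_max lexx.
have M0 : 0 <= M by exact: le_trans ler01 M1.
exists (M * Num.sqrt (4 * K)); first by rewrite mulr_ge0// sqrtr_ge0.
move=> l n j b nl jl jb.
pose m := (2 * l + 1)%N.
have bl : (b < (2 ^ l).+1)%N.
  by rewrite ltnS; case/andP: jb => _ /leq_trans; apply; rewrite leq_exp2l.
have SG : S cos n j b w ^+ (2 * m) + S sin n j b w ^+ (2 * m) <= G0 * D l j ^+ m.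
  rewrite -ler_pdivrMr ?exprn_gt0// mulrC; apply: le_trans (QG l).
  have t0 i1 i2 i3 : 0 <= D l i2 ^- m * (S cos i1 i2 i3 w ^+ (2 * m) +
      S sin i1 i2 i3 w ^+ (2 * m)).
    rewrite mulr_ge0 ?addr_ge0 ?exprn_even_ge0//.
    by rewrite invr_ge0 exprn_ge0// ltW.
  rewrite /Q (bigD1 (Ordinal nl))//= (bigD1 (Ordinal jl))//=.
  rewrite (bigD1 (Ordinal bl))/=; last by case/andP: jb.
  rewrite -!addrA lerDl !addr_ge0//.
  - by apply: sumr_ge0 => i _; exact: t0.
  - by apply: sumr_ge0 => i _; apply: sumr_ge0 => i' _; exact: t0.
  - apply: sumr_ge0 => i _; apply: sumr_ge0 => i' _; apply: sumr_ge0 => i'' _.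
    exact: t0.
have SM (y : R) : y ^+ (2 * m) <= G0 * D l j ^+ m ->
    `|y| <= M * Num.sqrt (4 * K) * Num.sqrt ((2 * l + 1) ^ th * 2 ^ j)%:R.
  move=> yG; rewrite -mulrA -sqrtrM; last by rewrite mulr_ge0// ltW.
  rewrite -/(D l j) leNgt; apply/negP => My.
  have sD : 0 < Num.sqrt (D l j) by rewrite sqrtr_gt0.
  pose z := `|y| / Num.sqrt (D l j).
  have Mz : M < z by rewrite ltr_pdivlMr.
  have zG : z ^+ (2 * m) <= G0.
    rewrite expr_div_n -exprn_even_norm [X in _ / X]exprM sqr_sqrtr ?(ltW (D0 _ _))//.
    by rewrite ler_pdivrMr// exprn_gt0.
  (* As z > M >= 1, this power only increases z, against z^(2m) <= G0 <= M. So [M] is free of a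
     2m-th root. *)
  have : z <= z ^+ (2 * m).
    by rewrite -{1}[z]expr1 ler_weXn2l ?(le_trans M1 (ltW Mz))// /m; lia.
  have : G0 <= M by rewrite le_max lexx orbT.
  by lra.
have c0 := exprn_even_ge0 (S cos n j b w) m.
have s0 := exprn_even_ge0 (S sin n j b w) m.
by split; apply: SM; apply: le_trans SG; rewrite ?lerDl ?lerDr.
Qed.

End AlmostSureGrowth.

(** * The Dirichlet series *)

Section ComplexSeries.
Variable R : realType.

Lemma normc_le_add (a b : R) : `|a +i* b| <= (`|a| + `|b|)%:C.
Proof.
have ab0 : 0 <= `|a| + `|b| by rewrite addr_ge0.
rewrite normc_def lecR /= -[leRHS]ger0_norm// -sqrtr_sqr.
rewrite ler_wsqrtr// -(real_normK (num_real a)) -(real_normK (num_real b)).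
have := mulr_ge0 (normr_ge0 a) (normr_ge0 b); nra.
Qed.

Lemma cvg_complex (u v : nat -> R) (a b : R) :
  u n @[n --> \oo] --> a -> v n @[n --> \oo] --> b ->
  ((u n +i* v n : R[i]^o) @[n --> \oo] --> (a +i* b : R[i]^o)).
Proof.
move=> ua vb; apply/cvgrPdist_le => eps.
(* A positive element of [R[i]] has zero imaginary part. *)
case: eps => e e' /=; rewrite ltcE /= => /andP[/eqP -> e0].
have e2 : 0 < e / 2 by rewrite divr_gt0.
move/cvgrPdist_le : ua => /(_ _ e2) ua; move/cvgrPdist_le : vb => /(_ _ e2) vb.
near=> n.
have un : `|a - u n| <= e / 2 by near: n.
have vn : `|b - v n| <= e / 2 by near: n.
have -> : (a +i* b : R[i]^o) - (u n +i* v n) = (a - u n) +i* (b - v n) by [].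
apply: (le_trans (normc_le_add _ _)); rewrite complexr0 lecR; lra.
Unshelve. all: by end_near. Qed.

Lemma cvg_ln_pinfty : ln (t : R) @[t --> +oo] --> +oo.
Proof.
apply/cvgryPge => A; near=> t.
have t0 : 0 < t by near: t; apply: nbhs_pinfty_gt; rewrite num_real.
have tA : expR A <= t by near: t; apply: nbhs_pinfty_ge; rewrite num_real.
by rewrite -(expRK A) ler_ln ?posrE ?expR_gt0.
Unshelve. all: by end_near. Qed.

Variable x : nat -> R.

Definition dcos (sigma t : R) (b : nat) : R :=
  \sum_(1 <= k < b) x k * pw sigma k * cos (t * ln k%:R).
Definition dsin (sigma t : R) (b : nat) : R :=
  \sum_(1 <= k < b) x k * pw sigma k * sin (t * ln k%:R).

Lemma natcpowV (sigma t : R) k : (natcpow k (sigma +i* t))^-1 =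
  (pw sigma k * cos (t * ln k%:R)) +i* - (pw sigma k * sin (t * ln k%:R)).
Proof.
apply: mulr1_eq; rewrite /natcpow /cexp /pw.
have -> : (sigma +i* t) * (ln k%:R)%:C = (sigma * ln k%:R) +i* (t * ln k%:R).
  by simpc.
rewrite /=; set L := sigma * _; set c := cos _; set s := sin _.
have cs : c ^+ 2 + s ^+ 2 = 1 by exact: cos2Dsin2.
have E := expRxMexpNx_1 L.
simpc; congr (_ +i* _); last by ring.
transitivity ((expR L * expR (- L)) * (c ^+ 2 + s ^+ 2)); first by ring.
by rewrite E cs mulr1.
Qed.

Lemma dirichlet_partialE (sigma t : R) n :
  dirichlet_partial x (sigma +i* t) n = dcos sigma t n.+1 +i* - dsin sigma t n.+1.
Proof.
rewrite /dirichlet_partial /dcos /dsin -sumrN.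
elim: n.+1 => [|m IHm]; first by rewrite !big_geq.
case: m IHm => [|m] IHm; first by rewrite !big_geq.
rewrite !(big_nat_recr m.+1)//= IHm natcpowV.
by simpc; congr (_ +i* _); rewrite mulrA.
Qed.

Lemma cvg_dyadic (S eps : nat -> R) : eps n @[n --> \oo] --> (0 : R) ->
  (forall J b, (2 ^ J <= b)%N -> `|S b - S (2 ^ J)%N| <= eps J) -> cvgn S.
Proof.
move=> eps0 Seps; apply: cauchy_cvg; apply: cauchy_exP => e e0.
move/cvgrPdist_lt : eps0 => /(_ _ e0) [J _ HJ].
have {}HJ := HJ J (leqnn J); rewrite sub0r normrN in HJ.
exists (S (2 ^ J)%N); exists (2 ^ J)%N => // b /= Jb.
rewrite /ball /= distrC; apply: (le_lt_trans (Seps _ _ Jb)).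
exact: le_lt_trans (ler_norm _) HJ.
Qed.

Lemma big_nat1_dyadic (f : nat -> R) J b : (2 ^ J <= b)%N ->
  \sum_(1 <= k < b) f k = \sum_(1 <= k < 2 ^ J) f k + \sum_(2 ^ J <= k < b) f k.
Proof. by move=> Jb; rewrite -big_cat_nat// expn_gt0. Qed.

Variables (G : R) (th : nat).
Hypotheses (G0 : 0 <= G) (th4 : (th <= 4)%N) (gr : dyadic_growth x G th).

Lemma trunc_decomp (t : R) : 0 <= t -> exists n (s : R),
  [/\ t = n%:R + s, 0 <= s <= 1 & n = Num.truncn t].
Proof.
move=> t0; exists (Num.truncn t), (t - (Num.truncn t)%:R); split => //.
  by rewrite addrC subrK.
by have /andP[h1] := truncn_itv t0; rewrite -natr1 => h2; apply/andP; split; lra.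
Qed.

Lemma trunc_log_lt n : (n < 2 ^ (trunc_log 2 n).+1)%N.
Proof. exact: trunc_log_ltn. Qed.

(** For fixed [t] the number [lam] is fixed, so the tail bound is geometric in [J] and the partial
    sums are Cauchy. *)
Lemma is_cvg_dcos_dsin (sigma t : R) : 1 / 2 < sigma -> 0 <= t ->
  cvgn (dcos sigma t) /\ cvgn (dsin sigma t).
Proof.
move=> sg t0; have [K K0 HK] := tail_le G0 sg th4 gr.
have [n [s [tE s01 _]]] := trunc_decomp t0.
pose lam := (trunc_log 2 n).+1.
pose q : R := expR (- ((sigma - 1 / 2) * ln 2)).
have ln20 : 0 < ln 2 :> R by have := @ln2_ge_half R; lra.
have q01 : 0 < q < 1.
  by rewrite expR_gt0 expR_lt1 oppr_lt0 mulr_gt0// subr_gt0.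
have [K1 K10 [r r01 Kr]] := sqr_geometric_le q01.
pose D : R := Num.sqrt ((2 * lam + 1) ^ th)%:R.
have D0 : 0 <= D by exact: sqrtr_ge0.
pose eps J := K * D * K1 * r ^+ J.
have epsJ J : K * expR (- ((sigma - 1 / 2) * (ln 2 * J%:R))) *
    Num.sqrt ((2 * (J + lam) + 1) ^ th)%:R <= eps J.
  have -> : expR (- ((sigma - 1 / 2) * (ln 2 * J%:R))) = q ^+ J.
    by rewrite /q -expRM_natl; congr expR; ring.
  have := @sqrt_odd_pow_le R 0 lam J th th4; rewrite !add0n -/D => h.
  have q0 : 0 <= q ^+ J by rewrite exprn_ge0// ltW//; case/andP: q01.
  have h1 := ler_wpM2l (mulr_ge0 K0 q0) h; apply: (le_trans h1).
  have h2 := ler_wpM2l (mulr_ge0 K0 D0) (Kr J).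
  move: h2; rewrite /eps -[X in _ -> _ <= X]mulrA; congr (_ <= _); ring.
have eps0 : eps J @[J --> \oo] --> (0 : R).
  rewrite -[X in _ --> X](mulr0 (K * D * K1)); apply: cvgM; first exact: cvg_cst.
  by apply: cvg_expr; case/andP: r01 => r0 r1; rewrite ger0_norm.
split; apply: (cvg_dyadic eps0) => J b Jb; rewrite /dcos /dsin (big_nat1_dyadic _ Jb).
- rewrite addrAC subrr add0r tE; apply: le_trans (epsJ J).
  by have [] := HK sigma s n lam J b (lexx _) s01 isT (trunc_log_lt n) Jb.
- rewrite addrAC subrr add0r tE; apply: le_trans (epsJ J).
  by have [] := HK sigma s n lam J b (lexx _) s01 isT (trunc_log_lt n) Jb.
Qed.

Lemma cvg_dirichlet_partial (sigma t : R) : 1 / 2 < sigma ->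
  dirichlet_partial x (sigma +i* t) n @[n --> \oo] -->
    (limn (dcos sigma t) +i* - limn (dsin sigma t) : R[i]^o).
Proof.
move=> sg; under eq_fun do rewrite dirichlet_partialE.
(* Negative [t] is reduced to positive by the parity of [cos] and [sin]. *)
have [cc cs] : cvgn (dcos sigma t) /\ cvgn (dsin sigma t).
  have [t0|/ltW t0] := leP 0 t; first exact: is_cvg_dcos_dsin.
  have Nt0 : 0 <= - t by rewrite oppr_ge0.
  have [cc cs] := is_cvg_dcos_dsin sg Nt0; split.
    have -> // : dcos sigma t = dcos sigma (- t).
    apply/funext => b; apply: eq_bigr => k _; by rewrite mulNr cosN.
  have -> : dsin sigma t = (fun b => - dsin sigma (- t) b).
    apply/funext => b; rewrite /dsin -sumrN; apply: eq_bigr => k _.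
    by rewrite mulNr sinN mulrN opprK.
  exact: is_cvgN.
apply: cvg_complex; first by rewrite (cvg_shiftS (dcos sigma t)).
by apply: cvgN; rewrite (cvg_shiftS (dsin sigma t)).
Qed.

Lemma is_cvg_dirichlet_partial (z : R[i]) : 1 / 2 < complex.Re z ->
  cvgn (dirichlet_partial x z).
Proof.
by case: z => sigma t /= sg; apply/cvg_ex; eexists; exact: cvg_dirichlet_partial.
Qed.

Lemma dirichlet_sumE (sigma t : R) : 1 / 2 < sigma ->
  dirichlet_sum x (sigma +i* t) = limn (dcos sigma t) +i* - limn (dsin sigma t).
Proof.
move=> sg; apply: (@cvg_lim (R[i]^o)); first exact: norm_hausdorff.
exact: cvg_dirichlet_partial.
Qed.

(** [w j] measures how full block j is: 1 in general, of order 1/j over the primes. Absolute values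
    suffice, and 2^(j(1 - sigma)) is bounded by its value at [J]. *)
Lemma head_le (C sigma : R) (w : nat -> R) (f : nat -> R) J :
  0 <= C -> 0 <= sigma <= 1 -> (forall j, 0 <= w j) ->
  (forall j, \sum_(2 ^ j <= k < 2 ^ j.+1) `|x k| <= C * (w j * 2 ^+ j)) ->
  (forall k, `|f k| <= 1) ->
  `|\sum_(1 <= k < 2 ^ J) x k * pw sigma k * f k| <=
    C * expR ((1 - sigma) * (ln 2 * J%:R)) * \sum_(j < J) w j.
Proof.
move=> C0 /andP[sg0 sg1] w0 xw f1.
have ln20 : 0 < ln 2 :> R by have := @ln2_ge_half R; lra.
pose E j := C * (w j * 2 ^+ j) * pw sigma (2 ^ j).
have E0 j : 0 <= E j by rewrite !mulr_ge0// ltW// pw_gt0.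
have blk j b : (0 <= j)%N -> (2 ^ j <= b <= 2 ^ j.+1)%N ->
    `|\sum_(2 ^ j <= k < b) x k * pw sigma k * f k| <= E j.
  move=> _ /andP[jb bj]; apply: (le_trans (ler_norm_sum _ _ _)).
  apply: (@le_trans _ _ (\sum_(2 ^ j <= k < b) `|x k| * pw sigma (2 ^ j))).
    rewrite !big_nat; apply: ler_sum => k /andP[jk kb].
    rewrite 2!normrM (gtr0_norm (pw_gt0 _ _)) -mulrA ler_wpM2l//.
    rewrite -[leRHS]mulr1; apply: ler_pM => //; first exact: ltW (pw_gt0 _ _).
    by apply: ler_pw; rewrite ?expn_gt0.
  rewrite -mulr_suml ler_wpM2r ?(ltW (pw_gt0 _ _))//.
  apply: le_trans (xw j); rewrite (big_cat_nat jb bj)/= lerDl.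
  by apply: sumr_ge0 => k _.
have J2 : (2 ^ 0 <= 2 ^ J <= 2 ^ (0 + J))%N by rewrite add0n leqnn expn_gt0.
have := dyadic_sum_le E0 blk J2; rewrite expn0 => /le_trans; apply.
rewrite mulr_sumr; apply: ler_sum => j _; rewrite add0n /E.
have -> : C * (w j * 2 ^+ j) * pw sigma (2 ^ j) =
    C * expR ((1 - sigma) * (ln 2 * j%:R)) * w j.
  rewrite /pw ln_exp2 -expR_ln2M.
  have -> : expR ((1 - sigma) * (ln 2 * j%:R)) =
      expR (ln 2 * j%:R) * expR (- (sigma * (ln 2 * j%:R))) :> R.
    by rewrite -expRD; congr expR; ring.
  by ring.
rewrite ler_wpM2r// ler_wpM2l// ler_expR ler_wpM2l ?subr_ge0//.
by rewrite ler_wpM2l ?(ltW ln20)// ler_nat ltnW.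
Qed.

(** Serves both conclusions: with l = ln (ln t), [Phi l] is the growth of the head weights, and the
    extra 1 next to their sum absorbs the tail. *)
Lemma dirichlet_bound (C sigma0 : R) (w : nat -> R) (Phi : R -> R) :
  0 <= C -> (0 < th <= 3)%N -> 1 / 2 < sigma0 -> (forall j, 0 <= w j) ->
  (forall j, \sum_(2 ^ j <= k < 2 ^ j.+1) `|x k| <= C * (w j * 2 ^+ j)) ->
  (exists K : R, \forall l \near +oo, forall J : nat, J%:R <= 6 * l ->
     \sum_(j < J) w j + 1 <= K * Phi l) ->
  exists K : R, \forall t \near +oo, forall sigma : R, sigma0 <= sigma <= 1 ->
    `|dirichlet_sum x (sigma +i* t)| <=
      (K * (ln t `^ (th%:R * (1 - sigma)) * Phi (ln (ln t))))%:C.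
Proof.
move=> C0 /andP[th0 th3] sg0 w0 xw [KW HW].
have [Kt Kt0 HKt] := tail_le G0 sg0 th4 gr.
(* The exponent left over in the tail is (sigma - 1/2) ln 2 + (5/2) th ln 2, at most 8 for th <= 3
   and sigma <= 1. *)
pose Kc : R := expR 9.
(* The 2 adds real and imaginary parts. *)
exists (2 * (C + Kt * Kc) * KW).
have ln2h := @ln2_ge_half R; have ln21 := @ln2_le1 R.
have lnlnoo : ln (ln (t : R)) @[t --> +oo] --> +oo.
  exact: (cvg_comp _ _ cvg_ln_pinfty cvg_ln_pinfty).
have HW2 : \forall t \near +oo, forall J : nat, J%:R <= 6 * ln (ln t) ->
    \sum_(j < J) w j + 1 <= KW * Phi (ln (ln t)).
  exact: lnlnoo _ HW.
near=> t => sigma /andP[sg sg1].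
have t1 : 1 < t by near: t; apply: nbhs_pinfty_gt; rewrite num_real.
have l1 : 1 <= ln (ln t).
  by near: t; move/cvgryPge : lnlnoo; apply.
have HWt : forall J : nat, J%:R <= 6 * ln (ln t) ->
    \sum_(j < J) w j + 1 <= KW * Phi (ln (ln t)).
  by near: t; exact: HW2.
set L := ln t; set l := ln L in l1 HWt *.
have L0 : 0 < L by exact: ln_gt0.
have LE : L = expR l by rewrite lnK ?posrE.
have lL : l <= L by rewrite LE; have := expR_ge1Dx l; lra.
have L1 : 1 <= L by lra.
have [n [s [tE s01 nE]]] := trunc_decomp (ltW (lt_trans ltr01 t1)).
have n1 : (1 <= n)%N by rewrite nE truncn_ge_nat ?(ltW t1)// ltW// (lt_trans ltr01).
pose lam := (trunc_log 2 n).+1.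
have lamL : lam%:R <= 1 + 2 * L.
  have : (2 ^ trunc_log 2 n <= n)%N by exact: trunc_logP.
  rewrite -(ler_nat R) => h.
  have nt : n%:R <= t by case/andP: s01 => ? _; rewrite tE; lra.
  have : ln (2 ^ trunc_log 2 n)%:R <= L.
    rewrite ler_ln ?posrE ?ltr0n ?expn_gt0 ?(lt_trans ltr01)//.
    exact: le_trans nt.
  rewrite ln_exp2 /lam -natr1 => h2.
  have := ler_wpM2r (ler0n R (trunc_log 2 n)) ln2h; lra.
(* The cut 2^J is the largest power of 2 below (ln t)^th, so ln 2 * J lies within ln 2 of th * l. *)
pose N := Num.truncn (L ^+ th).
have Lth1 : 1 <= L ^+ th by exact: exprn_ege1.
have /andP[N1 N2] := truncn_itv (le_trans ler01 Lth1).
have N0 : (0 < N)%N by rewrite /N truncn_ge_nat// (le_trans ler01).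
pose J := trunc_log 2 N.
have JN : (2 ^ J <= N)%N by exact: trunc_logP.
have NJ : (N < 2 ^ J.+1)%N by exact: trunc_log_ltn.
have lnLth : ln (L ^+ th) = th%:R * l by rewrite lnXn// mulr_natl.
have Jl : ln 2 * J%:R <= th%:R * l.
  rewrite -ln_exp2 -lnLth ler_ln ?posrE ?ltr0n ?expn_gt0 ?(lt_le_trans ltr01)//.
  by apply: le_trans N1; rewrite ler_nat.
have Jl' : th%:R * l <= ln 2 * J%:R + ln 2.
  have -> : ln 2 * J%:R + ln 2 = ln 2 * J.+1%:R :> R by rewrite -natr1; ring.
  rewrite -ln_exp2 -lnLth ler_ln ?posrE ?ltr0n ?expn_gt0 ?(lt_le_trans ltr01)//.
  by apply: le_trans (ltW N2) _; rewrite ler_nat.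
have th3R : th%:R <= 3 :> R by rewrite ler_nat.
have th0R : 0 <= th%:R :> R by [].
have J0R : 0 <= J%:R :> R by [].
have l0 : 0 <= l by lra.
have J6 : J%:R <= 6 * l.
  by have := ler_wpM2r J0R ln2h; have := ler_wpM2r l0 th3R; lra.
have {}HWt := HWt J J6.
have sg02 : 1 / 2 < sigma by lra.
set E := L `^ (th%:R * (1 - sigma)).
have EE : E = expR (th%:R * (1 - sigma) * l).
  by rewrite /E /powR (gt_eqF L0).
have E0 : 0 < E by rewrite EE expR_gt0.
have W0 : 0 <= \sum_(j < J) w j by apply: sumr_ge0.
have headE (f : nat -> R) : (forall k, `|f k| <= 1) ->
    `|\sum_(1 <= k < 2 ^ J) x k * pw sigma k * f k| <= C * E * \sum_(j < J) w j.
  move=> f1; have sg01 : 0 <= sigma <= 1 by apply/andP; split; lra.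
  apply: (le_trans (head_le J C0 sg01 w0 xw f1)).
  rewrite ler_wpM2r// ler_wpM2l// EE ler_expR.
  have h1 : 0 <= 1 - sigma by lra.
  by have := ler_wpM2l h1 Jl; lra.
have tailE : Kt * expR (- ((sigma - 1 / 2) * (ln 2 * J%:R))) *
    Num.sqrt ((2 * (J + lam) + 1) ^ th)%:R <= Kt * Kc * E.
  (* J <= 6L and lam <= 1 + 2L give at most 16L + 3 <= 32L. *)
  have m32 : (2 * (J + lam) + 1)%:R <= expR (5 * ln 2 + l) :> R.
    rewrite expRD -LE (_ : expR (5 * ln 2) = 2 ^+ 5); last by rewrite -expR_ln2M mulrC.
    rewrite natrD natrM natrD; have : (2 : R) ^+ 5 = 32 by ring.
    by move=> ->; lra.
  have sq : Num.sqrt ((2 * (J + lam) + 1) ^ th)%:R <=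
      expR (th%:R / 2 * (5 * ln 2 + l)) :> R.
    rewrite -[leRHS]ger0_norm ?expR_ge0// -sqrtr_sqr ler_wsqrtr// natrX.
    rewrite -expRM_natl (_ : 2 * _ = th%:R * (5 * ln 2 + l)); last by field.
    by rewrite expRM_natl lerXn2r ?nnegrE ?expR_ge0.
  rewrite -!mulrA ler_wpM2l//.
  apply: (@le_trans _ _ (expR (- ((sigma - 1 / 2) * (ln 2 * J%:R))) *
      expR (th%:R / 2 * (5 * ln 2 + l)))).
    by rewrite ler_wpM2l ?expR_ge0.
  rewrite /Kc EE -!expRD ler_expR.
  have h1 : 0 <= sigma - 1 / 2 by lra.
  have h2 := ler_wpM2l h1 Jl'.
  have h3 : (sigma - 1 / 2) * ln 2 <= (sigma - 1 / 2) * 1 by exact: ler_wpM2l.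
  have h4 : th%:R * ln 2 <= th%:R * 1 :> R by exact: ler_wpM2l.
  lra.
set B := E * ((C + Kt * Kc) * (KW * Phi l)).
have bB (cs : R -> R) : (forall z, `|cs z| <= 1) ->
    (forall b, (2 ^ J <= b)%N ->
      `|\sum_(2 ^ J <= k < b) x k * pw sigma k * cs (t * ln k%:R)| <=
       Kt * expR (- ((sigma - 1 / 2) * (ln 2 * J%:R))) *
         Num.sqrt ((2 * (J + lam) + 1) ^ th)%:R) ->
    forall b, (2 ^ J <= b)%N ->
      `|\sum_(1 <= k < b) x k * pw sigma k * cs (t * ln k%:R)| <= B.
  move=> cs1 Hcs b Jb; rewrite (big_nat1_dyadic _ Jb).
  apply: (le_trans (ler_normD _ _)).
  have h1 := headE (fun k => cs (t * ln k%:R)) (fun k => cs1 _).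
  have h2 := le_trans (Hcs b Jb) tailE.
  apply: (le_trans (lerD h1 h2)).
  have KK : 0 <= Kt * Kc by rewrite mulr_ge0// expR_ge0.
  have CK : 0 <= C + Kt * Kc by lra.
  have h3 := ler_wpM2l CK HWt.
  have h4 : C * (\sum_(j < J) w j) + Kt * Kc <=
      (C + Kt * Kc) * (\sum_(j < J) w j + 1).
    have := mulr_ge0 KK W0; lra.
  have := ler_wpM2l (ltW E0) (le_trans h4 h3); rewrite -/B; lra.
have [cc cs] := is_cvg_dcos_dsin sg02 (ltW (lt_trans ltr01 t1)).
have limB (u : nat -> R) : cvgn u -> (forall b, (2 ^ J <= b)%N -> `|u b| <= B) ->
    `|limn u| <= B.
  move=> cu uB; rewrite -lim_norm//; apply: limr_le; first exact: is_cvg_norm.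
  by exists (2 ^ J)%N.
have Hc b (Jb : (2 ^ J <= b)%N) :=
  HKt sigma s n lam J b sg s01 isT (trunc_log_lt n) Jb.
rewrite dirichlet_sumE//; apply: (le_trans (normc_le_add _ _)); rewrite lecR normrN.
have dc : `|limn (dcos sigma t)| <= B.
  apply: limB => //; apply: bB; first exact: cos_max.
  by move=> b Jb; rewrite tE; have [] := Hc b Jb.
have ds : `|limn (dsin sigma t)| <= B.
  apply: limB => //; apply: bB; first exact: sin_max.
  by move=> b Jb; rewrite tE; have [] := Hc b Jb.
rewrite -/L -/l -/E; apply: (le_trans (lerD dc ds)); rewrite /B; lra.
Unshelve. all: by end_near. Qed.

End ComplexSeries.

(** * Sums over primes *)

Section PrimeCount.
Local Open Scope nat_scope.

Lemma prime_dvd_fact p n : prime p -> p %| n`! -> (p <= n)%N.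
Proof.
move=> pp; elim: n => [|n IHn].
  by rewrite fact0 dvdn1 => /eqP p1; rewrite p1 in pp.
by rewrite factS Euclid_dvdM// => /orP[/dvdn_leq->//|/IHn/leqW].
Qed.

Lemma bin_le_exp2 n k : ('C(n, k) <= 2 ^ n)%N.
Proof.
have [nk|kn] := ltnP n k; first by rewrite bin_small.
rewrite -[2%N]/(1 + 1)%N expnDn (bigD1 (Ordinal (kn : (k < n.+1)%N)))//=.
by rewrite !exp1n !muln1 leq_addr.
Qed.

Lemma prod_primes_dvd (s : seq nat) N : uniq s -> all prime s ->
  (forall p, p \in s -> p %| N) -> \prod_(p <- s) p %| N.
Proof.
elim: s => [|p s IHs]; first by rewrite big_nil dvd1n.
move=> /= /andP[ps us] /andP[pp sp] sN; rewrite big_cons Gauss_dvd.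
  by rewrite sN ?mem_head//= IHs// => q qs; rewrite sN// inE qs orbT.
elim: s {IHs us sN} ps sp => [|q s IHs]; first by rewrite big_nil coprimen1.
rewrite inE negb_or /= => /andP[pq ps] /andP[qp sp].
by rewrite big_cons coprimeMr IHs// andbT prime_coprime// dvdn_prime2.
Qed.

(* Every prime in ]n, 2n[ divides the binomial coefficient 'C(2n, n) <= 4 ^ n. *)
Lemma prime_count_dyadic j :
  (j * count prime (index_iota (2 ^ j) (2 ^ j.+1)) <= 2 * 2 ^ j)%N.
Proof.
(* From exponent 2 on, 2^k is not prime, so the primes of the block exceed 2^k and do not divide
   (2^k)!. *)
case: j => [//|[//|j]]; set k := j.+2.
pose s := [seq p <- index_iota (2 ^ k) (2 ^ k.+1) | prime p].
have np : ~~ prime (2 ^ k).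
  apply/negP => p2k; have : 2 %| 2 ^ k by rewrite dvdn_exp.
  by rewrite dvdn_prime2// -{1}(expn1 2) eqn_exp2l.
have sP p : p \in s -> [/\ prime p, (2 ^ k < p)%N & (p < 2 ^ k.+1)%N].
  rewrite mem_filter mem_index_iota => /andP[pp /andP[kp pk]]; split => //.
  by rewrite ltn_neqAle kp andbT; apply: contra np => /eqP ->.
have dv : \prod_(p <- s) p %| 'C(2 * 2 ^ k, 2 ^ k).
  apply: prod_primes_dvd; first by rewrite filter_uniq// iota_uniq.
    by apply/allP => p /sP[].
  move=> p /sP[pp kp pk].
  have : p %| (2 * 2 ^ k)`! by rewrite dvdn_fact// prime_gt0//= -expnS ltnW.
  have kk : (2 ^ k <= 2 * 2 ^ k)%N by rewrite leq_pmull.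
  rewrite -(bin_fact kk) !Euclid_dvdM// (_ : 2 * 2 ^ k - 2 ^ k = 2 ^ k)%N; last first.
    by rewrite mul2n -addnn addnK.
  by case/or3P => // /(prime_dvd_fact pp); rewrite leqNgt kp.
(* Each prime of [s] exceeds 2^k, so their product is at least 2^(k * size s). *)
have : (2 ^ (k * size s) <= 2 ^ (2 * 2 ^ k))%N.
  apply: leq_trans (bin_le_exp2 _ (2 ^ k)).
  apply: leq_trans (dvdn_leq _ dv); last by rewrite bin_gt0 leq_pmull.
  rewrite expnM; elim: (s) sP => [|p s' IHs] sP; first by rewrite big_nil.
  rewrite big_cons /= expnS leq_mul//; last first.
    by apply: IHs => q qs; apply: sP; rewrite inE qs orbT.
  by have [_ /ltnW] := sP p (mem_head _ _).
by rewrite leq_exp2l// /s size_filter.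
Qed.

End PrimeCount.

Section BlockWeights.
Variables (R : realType) (x : nat -> R) (C : R).
Hypothesis xC : forall k, (0 < k)%N -> `|x k| <= C.
Hypothesis C0 : 0 <= C.

Lemma block_abs_le j :
  \sum_(2 ^ j <= k < 2 ^ j.+1) `|x k| <= C * (1 * 2 ^+ j).
Proof.
apply: (@le_trans _ _ (\sum_(2 ^ j <= k < 2 ^ j.+1) C)).
  rewrite !big_nat; apply: ler_sum => k /andP[jk _]; apply: xC.
  by apply: leq_trans jk; rewrite expn_gt0.
rewrite sumr_const_nat expnS mul2n -addnn addnK -[_ *+ _]mulr_natr natrX mul1r.
exact: lexx.
Qed.

(** Chebyshev's bound 2 * 2^j / j, with the trivial weight for block 0, where it says nothing. *)
Definition prime_weight (j : nat) : R := if j is j'.+1 then 2 / j'.+1%:R else 1.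

Lemma prime_weight_ge0 j : 0 <= prime_weight j.
Proof. by case: j => //= j; rewrite divr_ge0. Qed.

Lemma block_abs_prime_le j : (forall k, (0 < k)%N -> ~~ prime k -> x k = 0) ->
  \sum_(2 ^ j <= k < 2 ^ j.+1) `|x k| <= C * (prime_weight j * 2 ^+ j).
Proof.
move=> x0; case: j => [|j]; first exact: block_abs_le.
apply: (@le_trans _ _ (\sum_(2 ^ j.+1 <= k < 2 ^ j.+2) C *+ prime k)).
  rewrite !big_nat; apply: ler_sum => k /andP[jk _].
  have k0 : (0 < k)%N by apply: leq_trans jk; rewrite expn_gt0.
  by have [pk|npk] := boolP (prime k); [exact: xC|rewrite x0// normr0].
rewrite sumrMnr -[_ *+ _]mulr_natr ler_wpM2l//=.
rewrite mulrAC ler_pdivlMr ?ltr0n// mulrC -natrM -natrX -natrM ler_nat.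
have -> : (\sum_(2 ^ j.+1 <= i < 2 ^ j.+2) prime i =
    count prime (index_iota (2 ^ j.+1) (2 ^ j.+2)))%N.
  by rewrite -sum1_count [RHS]big_mkcond; apply: eq_bigr => i _; case: prime.
exact: prime_count_dyadic.
Qed.

(** The increment is ln (1 - 1/(J + 2)) <= -1/(J + 2). *)
Lemma harmonic_le (J : nat) : (0 < J)%N ->
  \sum_(j < J) j.+1%:R^-1 <= 1 + ln J%:R :> R.
Proof.
case: J => // J _; elim: J => [|J IHJ].
  by rewrite big_ord_recr big_ord0/= add0r invr1 ln1 addr0.
rewrite big_ord_recr/=; apply: (le_trans (lerD IHJ (lexx _))).
rewrite -addrA lerD2l.
have J0 : 0 < J.+1%:R :> R by rewrite ltr0n.
have J1 : 0 < J.+2%:R :> R by rewrite ltr0n.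
have iJ : J.+2%:R^-1 < 1 :> R by rewrite invf_lt1// ltr1n.
have := @le_ln1Dx R (- J.+2%:R^-1).
have -> : 1 + - J.+2%:R^-1 = J.+1%:R / J.+2%:R :> R.
  have -> : J.+1%:R = J.+2%:R - 1 :> R by rewrite -[J.+2%:R]natr1 addrK.
  by rewrite mulrBl divff ?gt_eqF// mul1r.
rewrite ltrN2 => /(_ iJ); rewrite ln_div ?posrE//.
move: (J.+2%:R^-1 : R) (ln J.+1%:R : R) (ln J.+2%:R : R) => i a b.
by lra.
Qed.

Lemma cst_weight_sum : exists K : R, \forall l \near +oo,
  forall J : nat, J%:R <= 6 * l -> \sum_(j < J) (1 : R) + 1 <= K * l.
Proof.
exists 7; near=> l => J Jl.
have l1 : 1 <= l by near: l; apply: nbhs_pinfty_ge; rewrite num_real.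
by rewrite sumr_const card_ord; lra.
Unshelve. all: by end_near. Qed.

Lemma prime_weight_sum : exists K : R, \forall l \near +oo,
  forall J : nat, J%:R <= 6 * l -> \sum_(j < J) prime_weight j + 1 <= K * ln l.
Proof.
(* The sum is at most 1 + 2 (1 + ln 6 + ln l) + 1, with ln 6 <= 5 and ln l >= 1. *)
exists 16; near=> l => J Jl.
have l1 : 1 <= l by near: l; apply: nbhs_pinfty_ge; rewrite num_real.
have ll1 : 1 <= ln l.
  near: l; have := @cvg_ln_pinfty R; move/cvgryPge; exact.
case: J Jl => [|J] Jl; first by rewrite big_ord0; lra.
rewrite big_ord_recl/=.
have -> : \sum_(i < J) prime_weight (bump 0 i) = 2 * \sum_(i < J) i.+1%:R^-1.
  by rewrite mulr_sumr; apply: eq_bigr => i _; rewrite /bump leq0n add1n.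
case: J Jl => [|J] Jl; first by rewrite big_ord0; lra.
have H := @harmonic_le J.+1 isT.
have J0 : 0 < J.+1%:R :> R by rewrite ltr0n.
have : ln J.+1%:R <= ln 6 + ln l.
  have l0 : 0 < l by exact: lt_le_trans l1.
  rewrite -lnM ?posrE// ler_ln ?posrE ?mulr_gt0//.
  by move: Jl; rewrite -[J.+2%:R]natr1; lra.
have : ln 6 <= 5 :> R.
  have -> : 6 = 1 + 5 :> R by ring.
  by apply: le_ln1Dx; lra.
by lra.
Unshelve. all: by end_near. Qed.

End BlockWeights.

(** * Bounded versions of the variables and conclusion *)

Lemma bounded_representative (R : realType) (d : measure_display)
    (T : measurableType d) (P : probability T R) (X : nat -> {RV P >-> R})
    (C theta : R) : 0 < C ->
  (forall k, (0 < k)%N -> ('E_P[X k] = 0)%E) ->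
  (forall k, (0 < k)%N -> {ae P, forall w, `|X k w| <= C}) ->
  [\/ theta = 1 /\ mutually_independent P X,
      theta = 2 /\ martingale_difference P X
    | theta = 3 /\ rho_star_mixing P X] ->
  exists (Y : nat -> T -> R) (th : nat),
    [/\ theta = th%:R /\ (0 < th <= 3)%N,
        forall k, bounded_wrt measurable (Y k), forall k w, `|Y k w| <= C,
        forall k, (0 < k)%N -> {ae P, forall w, Y k w = X k w}
      & moment_bound P Y th].
Proof.
move=> C0 X0 XC dep.
have mX k : measurable_fun setT (X k) by exact: measurable_funP.
have bclip k : bounded_wrt measurable (fun w => clip C (X k w)).
  by apply: bounded_wrt_clip (ltW C0) _; apply/measurable_wrt_measurable.
have clipX k : (0 < k)%N -> {ae P, forall w, clip C (X k w) = X k w}.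
  by move=> k0; apply: filterS (XC k k0) => w; exact: clip_id.
have mean0 k : (0 < k)%N -> mean P (fun w => clip C (X k w)) = 0.
  move=> k0; rewrite /mean (Rintegral_ae_eq measurableT _ _ (clipX k k0))//.
    by have := X0 k k0; rewrite unlock /Rintegral => ->.
  by apply/measurable_wrt_measurable; exact: (bclip k).1.
case: dep => -[-> dep].
- exists (fun k w => if k == 0%N then 0 else clip C (X k w)), 1%N; split => //.
  + case=> [|k] /=; last exact: bclip.
    by apply: bounded_wrt_cst; exact: sigma_algebra_measurable.
  + by case=> [|k] w /=; [rewrite normr0 ltW|exact: norm_clip_le (ltW C0)].
  + by case=> [//|k] _ /=; exact: clipX.
  + exact: independent_moment_bound.
- have [Y [bY YC YX mY]] := martingale_difference_moment_bound C0 XC dep.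
  by exists Y, 2%N; split => //; exact: moment_boundS.
- have [n0 n00 rho2] : exists2 n0, (0 < n0)%N & rho_star P X n0 <= 1 / 2.
    have half : 0 < 1 / 2 :> R by lra.
    move/cvgrPdist_le : dep => /(_ _ half) [N _ HN].
    (* The successor makes the modulus of the residue classes positive. *)
    exists N.+1 => //; have := HN N.+1 (leqnSn N).
    by rewrite sub0r normrN; apply: le_trans; exact: ler_norm.
  exists (fun k w => clip C (X k w)), 3%N; split => //.
    by move=> k w; exact: norm_clip_le (ltW C0).
  apply: (mixing_moment_bound mX _ C0 _ mean0 n00 rho2).
    move=> k; apply: bounded_wrt_clip (ltW C0) _.
    move=> B mB; apply: sub_sigma_algebra; exists k => //.
    by exists B => //; rewrite setTI.
  by move=> k w; exact: norm_clip_le (ltW C0).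
Qed.

Lemma eq_dirichlet_partial (R : realType) (x y : nat -> R) :
  (forall k, (0 < k)%N -> x k = y k) -> dirichlet_partial x = dirichlet_partial y.
Proof.
move=> xy; apply/funext => z; apply/funext => n; rewrite /dirichlet_partial !big_nat.
by apply: eq_bigr => k /andP[k0 _]; rewrite xy.
Qed.

Lemma eq_dirichlet_sum (R : realType) (x y : nat -> R) :
  (forall k, (0 < k)%N -> x k = y k) -> dirichlet_sum x = dirichlet_sum y.
Proof. by move=> xy; rewrite /dirichlet_sum (eq_dirichlet_partial xy). Qed.

Unset Implicit Arguments.

Theorem theorem3p1 (R : realType) (d : measure_display) (T : measurableType d)
    (P : probability T R) (X : nat -> {RV P >-> R}) (C sigma0 theta : R)
    (C_gt0 : 0 < C)
    (X_mean : forall k, (0 < k)%N -> ('E_P[X k] = 0)%E)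
    (X_bound : forall k, (0 < k)%N -> {ae P, forall w, `|X k w| <= C})
    (sigma0_gt : 1 / 2 < sigma0) (sigma0_le : sigma0 <= 1)
    (X_dep : [\/ theta = 1 /\ mutually_independent P X,
                 theta = 2 /\ martingale_difference P X
               | theta = 3 /\ rho_star_mixing P X]) :
  [/\ {ae P, forall w, forall z : R[i], 1 / 2 < complex.Re z ->
         cvgn (dirichlet_partial (fun k => X k w) z)},
      {ae P, forall w, exists K : R, \forall t \near +oo,
         forall sigma : R, sigma0 <= sigma <= 1 ->
           `|dirichlet_sum (fun k => X k w) (sigma +i* t)| <=
             (K * (ln t `^ (theta * (1 - sigma)) * ln (ln t)))%:C}
    & (forall k, (0 < k)%N -> ~~ prime k -> {ae P, forall w, X k w = 0}) ->
      {ae P, forall w, exists K : R, \forall t \near +oo,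
         forall sigma : R, sigma0 <= sigma <= 1 ->
           `|dirichlet_sum (fun k => X k w) (sigma +i* t)| <=
             (K * (ln t `^ (theta * (1 - sigma)) * ln (ln (ln t))))%:C}].
Proof.
have [Y [th [[-> th03] bY YC YX mY]]] :=
  bounded_representative C_gt0 X_mean X_bound X_dep.
have th4 : (th <= 4)%N by case/andP: th03 => _ /leqW.
(* A countable union of null sets is discarded once, after which both Dirichlet series coincide at
   every point of the plane. *)
have XY : {ae P, forall w, forall k, (0 < k)%N -> X k w = Y k w}.
  apply: ae_foralln => -[|k]; first by apply: aeW.
  by apply: filterS (YX k.+1 isT) => w.
have gr := ae_dyadic_growth bY mY.
have YC' w k : (0 < k)%N -> `|Y k w| <= C by move=> _; exact: YC.
split.
- move: gr XY; apply: filterS2 => w [G G0 grw] XYw z zre.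
  rewrite (eq_dirichlet_partial XYw).
  exact: (is_cvg_dirichlet_partial G0 th4 grw).
- move: gr XY; apply: filterS2 => w [G G0 grw] XYw.
  rewrite (eq_dirichlet_sum XYw).
  apply: (@dirichlet_bound _ (Y ^~ w) G th G0 th4 grw C sigma0 (fun=> 1) id) => //.
  + exact: ltW.
  + exact: block_abs_le (YC' w).
  + exact: cst_weight_sum.
- move=> X0.
  have XP : {ae P, forall w, forall k, (0 < k)%N -> ~~ prime k -> X k w = 0}.
    apply: ae_foralln => k; have [k0|] := boolP (0 < k)%N; last by move=> _; apply: aeW.
    have [kp|/X0] := boolP (prime k); first by apply: aeW.
    by move=> /(_ k0); apply: filterS.
  have YP : {ae P, forall w, forall k, (0 < k)%N -> ~~ prime k -> Y k w = 0}.
    by move: XP XY; apply: filterS2 => w XPw XYw k k0 /(XPw k k0); rewrite XYw.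
  move: gr XY YP; apply: filterS3 => w [G G0 grw] XYw YPw.
  rewrite (eq_dirichlet_sum XYw).
  apply: (@dirichlet_bound _ (Y ^~ w) G th G0 th4 grw C sigma0
    (@prime_weight R) (@ln R)) => //.
  + exact: ltW.
  + exact: prime_weight_ge0.
  + by move=> j; apply: (block_abs_prime_le (YC' w) (ltW C_gt0)) => k; exact: YPw.
  + exact: prime_weight_sum.
Qed.
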